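(* Under the $\mathrm{SL}_2(\mathbb C)$-equivariant identification $\mathrm P(\mathfrak{sl}_2(\mathbb C))\simeq S^2(\mathbb{CP}^1)$, $[L]\mapsto\{\zeta_1,\zeta_2\}$, described in the context, the orbits of $\mathrm{Aut}(\mathrm{SL}_2(\mathbb R))$ in $\mathrm P(\mathfrak{sl}_2(\mathbb C))_{\mathrm{reg}}$ correspond to the following two 1-parameter families of orbits in $S^2(\mathbb{CP}^1)$: I. A 1-parameter family of orbits, corresponding to pairs of points $\zeta_1,\zeta_2\in\mathbb C\setminus\mathbb R$ in the same half-plane (upper or lower). The parameter can be taken as the hyperbolic distance $d(\zeta_1,\zeta_2)\in[0,\infty)$. All these orbits are 3-dimensional, except the one corresponding to a double point $\zeta_1=\zeta_2$, which is 2-dimensional. II. A 1-parameter family of orbits, corresponding to pairs of points $\zeta_1,\zeta_2\in\mathbb C\setminus\mathbb R$ situated in opposite half-planes and which are not complex conjugate, $\zeta_1\neq\bar\zeta_2$. The parameter can be taken as the hyperbolic distance $d(\zeta_1,\bar\zeta_2)\in(0,\infty)$. All these orbits are 3-dimensional. The rest of the orbits in $\mathrm P(\mathfrak{sl}_2(\mathbb C))$ are either real ($\zeta_1,\zeta_2\in\mathbb{RP}^1=\mathbb R\cup\infty$, or $\zeta_1=\bar\zeta_2$) or degenerate (one of the points is real).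
   Context: $\mathfrak{sl}_2(\mathbb C)=\mathfrak{sl}_2(\mathbb R)\otimes\mathbb C$ (traceless $2\times2$ matrices). $S^2(\mathbb{CP}^1)$ is the set of unordered pairs $\{\zeta_1,\zeta_2\}$, possibly repeated, of points of $\mathbb{CP}^1=\mathbb C\cup\infty$. The identification sends $[L]$, $L=\begin{pmatrix}a&b\\c&-a\end{pmatrix}\ne0$, to the roots $\{\zeta_1,\zeta_2\}$ of $p_L(\zeta)=c\zeta^2-2a\zeta-b$ (a polynomial of formal degree 2: $\infty$ is counted as a root when the degree drops). It is equivariant for the conjugation action of $\mathrm{SL}_2(\mathbb C)$ on $\mathrm P(\mathfrak{sl}_2(\mathbb C))$ and the M\''obius action on $\mathbb{CP}^1$. A point $[L]\in\mathrm P(\mathfrak{sl}_2(\mathbb C))$ is real if $[L]=[\overline L]$, degenerate if $L,\overline L$ span a Lie subalgebra of $\mathfrak{sl}_2(\mathbb C)$, and regular if it is neither real nor degenerate; $\mathrm P(\mathfrak{sl}_2(\mathbb C))_{\mathrm{reg}}$ is the set of regular points (these parametrize the left-invariant non-degenerate CR structures on $\mathrm{SL}_2(\mathbb R)$). $\mathrm{Aut}(\mathrm{SL}_2(\mathbb R))$ is the group of Lie group automorphisms of $\mathrm{SL}_2(\mathbb R)$, acting on $\mathrm P(\mathfrak{sl}_2(\mathbb C))$ by the projectivized complexification of its action on $\mathfrak{sl}_2(\mathbb R)$. $d$ is the hyperbolic distance of the Poincar\'e metric $|\mathrm d\zeta|/|\mathrm{Im}\,\zeta|$ in each of the upper and lower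 half-planes. *)

(* Defs.v *)
From HB Require Import structures.
From mathcomp Require Import all_boot all_order all_algebra.
From mathcomp Require Import finmap multiset complex ring.
From mathcomp Require Import all_classical all_reals all_analysis.

Set Implicit Arguments.
Unset Strict Implicit.
Unset Printing Implicit Defensive.

Import Order.TTheory GRing.Theory Num.Theory.
Import numFieldNormedType.Exports.

Local Open Scope classical_set_scope.
Local Open Scope ring_scope.

Section Smooth.
Context {R : realType}.

(* On an open subset U of a finite-dimensional space, f is of class C^(k+1) iff
   it is differentiable and all its directional derivatives are C^k. *)
Fixpoint Ck (k : nat) (V W : normedModType R) (U : set V) (f : V -> W) : Prop :=
  match k with
  | 0 => forall x, U x -> {for x, continuous f}
  | k'.+1 => (forall x, U x -> differentiable f x) /\
             (forall v : V, Ck k' U (fun x => 'D_v f x))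
  end.

Definition smooth_on (V W : normedModType R) (U : set V) (f : V -> W) : Prop :=
  forall k, Ck k U f.

(* smoothness of a map defined on an arbitrary subset A: existence of local
   smooth extensions *)
Definition smooth_subset (V W : normedModType R) (A : set V) (f : V -> W) :=
  forall x, A x -> exists (U : set V) (F : V -> W),
    [/\ open U, U x, smooth_on U F & forall y, U y -> A y -> F y = f y].

(* S is an embedded submanifold of R^n of codimension m: near each of its points
   it is the zero set of m smooth functions with independent differentials. *)
Definition submanifold_codim (n m : nat) (S : set 'rV[R]_n) : Prop :=
  forall x, S x -> exists (U : set 'rV[R]_n) (h : 'I_m -> 'rV[R]_n -> R),
    [/\ open U, U x, forall i, smooth_on U (h i),
        forall y, U y -> (S y <-> forall i, h i y = 0)
      & row_free (\matrix_(i < m, j < n) 'D_(delta_mx 0 j) (h i) x)].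

End Smooth.

Section SL2R.
Variable R : realType.

Definition SL2 : set 'M[R]_2 := [set g | \det g = 1].

(* Only the restriction of phi to SL2 is relevant. *)
Definition lie_aut (phi : 'M[R]_2 -> 'M[R]_2) : Prop :=
  exists psi : 'M[R]_2 -> 'M[R]_2,
  [/\ (forall g, SL2 g -> SL2 (phi g)) /\ (forall g, SL2 g -> SL2 (psi g)),
      forall g h, SL2 g -> SL2 h -> phi (g *m h) = phi g *m phi h,
      (forall g, SL2 g -> psi (phi g) = g) /\
        (forall g, SL2 g -> phi (psi g) = g),
      smooth_subset SL2 phi
    & smooth_subset SL2 psi].

(* Differential at the identity of phi : SL2 -> SL2, on sl_2(R) = T_1 SL2: it
   maps the velocity of a curve through 1 to the velocity of its image. *)
Definition lie_diff (phi : 'M[R]_2 -> 'M[R]_2) (X : 'M[R]_2) : 'M[R]_2 :=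
  xget 0 [set Y | forall gamma : R -> 'M[R]_2,
    (forall t, SL2 (gamma t)) -> gamma 0 = 1%:M ->
    is_derive (0 : R) 1 gamma X -> is_derive (0 : R) 1 (phi \o gamma) Y].

Local Notation C := (R[i]).

Definition complexify (f : 'M[R]_2 -> 'M[R]_2) (L : 'M[C]_2) : 'M[C]_2 :=
  map_mx (real_complex R) (f (map_mx (@complex.Re R) L)) +
  (Complex 0 1 : C) *: map_mx (real_complex R) (f (map_mx (@complex.Im R) L)).

End SL2R.

Section Projective.
Variable R : realType.
Local Notation C := (R[i]).

Definition sl2C : {vspace 'M[C]_2} := 
  lker (linfun (fun L : 'M[C]_2 => \tr L : C^o)).

(* points of P(sl_2(C)): the lines of sl_2(C) *)
Definition Psl2C :=
  {l : {vspace 'M[C]_2} | (l <= sl2C)%VS && (\dim l == 1%N)}.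

Definition pt_rep (p : Psl2C) : 'M[C]_2 := vpick (val p).

Definition mxconj (L : 'M[C]_2) : 'M[C]_2 := map_mx (@conjc R) L.

Definition real_pts : set Psl2C :=
  [set p | <[pt_rep p]>%VS = <[mxconj (pt_rep p)]>%VS].

Definition degenerate_pts : set Psl2C :=
  [set p | let l := <<[:: pt_rep p; mxconj (pt_rep p)]>>%VS in
           forall X Y, X \in l -> Y \in l -> X *m Y - Y *m X \in l].

Definition regular_pts : set Psl2C := ~` (real_pts `|` degenerate_pts).

Definition orbit (p : Psl2C) : set Psl2C :=
  [set q : Psl2C | exists2 phi, lie_aut phi &
     [set` val q] = complexify (lie_diff phi) @` [set` val p]].

Definition orbits : set (set Psl2C) := range orbit.

Definition sl2mx (a b c : C) : 'M[C]_2 :=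
  \matrix_(i, j) if i == 0 then if j == 0 then a else b
                 else if j == 0 then c else - a.

(* The three standard affine charts of P(sl_2(C)) = CP^2 in the homogeneous
   coordinates (a, b, c), with C^2 = R^4. *)
Definition affine_chart (j : 'I_3) (x : 'rV[R]_4) : 'M[C]_2 :=
  let u := Complex (x 0 (inord 0)) (x 0 (inord 1)) in
  let v := Complex (x 0 (inord 2)) (x 0 (inord 3)) in
  match val j with
  | 0 => sl2mx 1 u v
  | 1 => sl2mx u 1 v
  | _ => sl2mx u v 1
  end.

Definition has_dim (S : set Psl2C) (k : nat) : Prop :=
  (k <= 4)%N /\
  forall j, submanifold_codim (4 - k)
    [set x | exists2 p : Psl2C, S p & val p = <[affine_chart j x]>%VS].

End Projective.

Section Roots.
Variable R : realType.
Local Notation C := (R[i]).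
Local Notation Psl2C := (Psl2C R).

(* None is the point at infinity *)
Definition CP1 := option C.

Definition RP1 : set CP1 :=
  [set z | if z is Some x then complex.Im x = 0 else True].

Definition CP1_conj : CP1 -> CP1 := omap (@conjc R).

(* unordered pairs: multisets with two elements *)
Definition S2CP1 := {s : {mset CP1}%mset | size s == 2%N}.

Fact upair_subproof (z w : CP1) : size (seq_mset [:: z; w]) == 2%N.
Proof. by rewrite (perm_size (perm_eq_seq_mset _)). Qed.

Definition upair (z w : CP1) : S2CP1 :=
  Sub (seq_mset [:: z; w]) (upair_subproof z w).

Definition root_poly (L : 'M[C]_2) : {poly C} :=
  L 1 0 *: 'X^2 - (2 * L 0 0) *: 'X - (L 0 1)%:P.

(* the roots of root_poly L with multiplicity, then infinity repeated
   2 - deg (root_poly L) times *)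
Definition root_seq (L : 'M[C]_2) : seq CP1 :=
  let r := sval (closed_field_poly_normal (root_poly L)) in
  map Some r ++ nseq (2 - size r) None.

Lemma mem_sl2C (L : 'M[C]_2) : (L \in sl2C R) = (L 1 1 == - L 0 0).
Proof.
rewrite memv_ker lfunE /= /mxtrace !big_ord_recl big_ord0 addr0.
have -> : lift ord0 ord0 = 1 :> 'I_2 by exact/val_inj.
by rewrite addrC addr_eq0.
Qed.

Lemma matrix2P (L M : 'M[C]_2) : L 0 0 = M 0 0 -> L 0 1 = M 0 1 ->
  L 1 0 = M 1 0 -> L 1 1 = M 1 1 -> L = M.
Proof.
move=> h00 h01 h10 h11; apply/matrixP => i j.
have ord2 (k : 'I_2) : k = 0 \/ k = 1.
  by case: k => [[|[|//]]] ?; [left | right]; exact/val_inj.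
by case: (ord2 i) => ->; case: (ord2 j) => ->.
Qed.

Lemma sl2mxE (a b c : C) : (sl2mx a b c 0 0 = a) * (sl2mx a b c 0 1 = b) *
  (sl2mx a b c 1 0 = c) * (sl2mx a b c 1 1 = - a).
Proof. by rewrite !mxE. Qed.

(* the element of sl_2(C), unique up to scaling, with roots z and w *)
Definition pair_mx (z w : CP1) : 'M[C]_2 :=
  match z, w with
  | Some x, Some y => sl2mx ((x + y) / 2) (- (x * y)) 1
  | Some x, None | None, Some x => sl2mx (1 / 2) (- x) 0
  | None, None => sl2mx 0 (- 1) 0
  end.

Lemma pair_mxC z w : pair_mx z w = pair_mx w z.
Proof. by case: z w => [x|] [y|] //=; rewrite addrC [x * y]mulrC. Qed.

Lemma pair_mx_sl2C z w : pair_mx z w \in sl2C R.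
Proof. by rewrite mem_sl2C; case: z w => [x|] [y|]; rewrite !sl2mxE. Qed.

Let two : (2 : C) != 0.
Proof. by rewrite pnatr_eq0. Qed.

Lemma pair_mx_neq0 z w : pair_mx z w != 0.
Proof.
apply/eqP => /matrixP e; case: z w e => [x|] [y|] e.
- by have /eqP := e 1 0; rewrite !mxE/= oner_eq0.
- by have /eqP := e 0 0; rewrite !mxE/= mul1r invr_eq0 (negbTE two).
- by have /eqP := e 0 0; rewrite !mxE/= mul1r invr_eq0 (negbTE two).
- by have /eqP := e 0 1; rewrite !mxE/= oppr_eq0 oner_eq0.
Qed.

Lemma pair_mx_exists L : L \in sl2C R -> L != 0 ->
  exists z w k, k != 0 /\ L = k *: pair_mx z w.
Proof.
rewrite mem_sl2C => /eqP trL L0.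
have [c0|c0] := eqVneq (L 1 0) 0.
  have [a0|a0] := eqVneq (L 0 0) 0.
    exists None, None, (- L 0 1); split.
      apply: contra L0; rewrite oppr_eq0 => /eqP b0; apply/eqP.
      by apply: matrix2P; rewrite ?mxE// trL a0 oppr0.
    by apply: matrix2P; rewrite mxE sl2mxE ?trL ?a0 ?c0; ring.
  exists (Some (- L 0 1 / (2 * L 0 0))), None, (2 * L 0 0).
  split; first by rewrite mulf_neq0.
  by apply: matrix2P; rewrite mxE sl2mxE ?trL ?c0; field; rewrite ?a0.
have /closed_rootP[x] : size (root_poly L) != 1%N.
  rewrite (_ : size _ = 3%N)// /root_poly -addrA size_polyDl.
    by rewrite size_scale// size_polyXn.
  rewrite size_scale// size_polyXn -opprD size_polyN.
  apply: leq_ltn_trans (size_polyD _ _) _; rewrite gtn_max.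
  rewrite (leq_ltn_trans (size_scale_leq _ _)) ?size_polyX//.
  by rewrite (leq_ltn_trans (size_polyC_leq1 _)).
move=> /rootP rx0.
have {rx0}rx : L 1 0 * x ^+ 2 - 2 * L 0 0 * x - L 0 1 = 0.
  by rewrite -[RHS]rx0 /root_poly !hornerE; ring.
exists (Some x), (Some (2 * L 0 0 / L 1 0 - x)), (L 1 0); split => //.
apply: matrix2P; rewrite mxE sl2mxE ?trL; try by field; rewrite ?c0.
transitivity (L 0 1 + (L 1 0 * x ^+ 2 - 2 * L 0 0 * x - L 0 1)).
  by rewrite rx addr0.
by field; rewrite ?c0.
Qed.

Lemma prod_XsubC_perm (k : C) (r s : seq C) : k != 0 ->
  r = sval (closed_field_poly_normal (k *: \prod_(z <- s) ('X - z%:P))) ->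
  perm_eq r s.
Proof.
move=> k0; case: closed_field_poly_normal => t /= + ->.
rewrite lead_coefZ (monicP _) ?monic_prod_XsubC// mulr1.
by move=> /(scalerI k0)/prod_XsubC_eq; rewrite perm_sym.
Qed.

Lemma scaled_mxE (k : C) (L : 'M[C]_2) i j : (k *: L) i j = k * L i j.
Proof. exact: mxE. Qed.

Lemma root_seq_pair k z w : k != 0 ->
  perm_eq (root_seq (k *: pair_mx z w)) [:: z; w].
Proof.
move=> k0.
have H l (s : seq C) L : l != 0 ->
    root_poly L = l *: \prod_(z <- s) ('X - z%:P) ->
    perm_eq (root_seq L) (map Some s ++ nseq (2 - size s) None).
  move=> l0 e; rewrite /root_seq e.
  set r := sval _.
  have rs : perm_eq r s by exact: (prod_XsubC_perm l0 (erefl r)).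
  by rewrite (perm_size rs) perm_cat2r perm_map.
have mono x : root_poly (k *: sl2mx (1 / 2) (- x) 0) =
    (- k) *: \prod_(z <- [:: x]) ('X - z%:P).
  rewrite big_seq1 /root_poly !scaled_mxE !sl2mxE mulr0 scale0r.
  rewrite (_ : 2 * (k * _) = k); last by field.
  by rewrite -!mul_polyC mulrN !polyCN polyCM; ring.
case: z w => [x|] [y|] /=.
- apply: (H k [:: x; y]) => //.
  rewrite big_cons big_seq1 /root_poly !scaled_mxE !sl2mxE.
  rewrite (_ : 2 * (k * _) = k * (x + y)); last by field.
  by rewrite -!mul_polyC mulrN !polyCN !polyCM polyCD polyC1; ring.
- by apply: (H (- k) [:: x]); rewrite ?oppr_eq0 ?mono.
- rewrite perm_sym -[[:: None; Some y]]/([:: None] ++ [:: Some y]) perm_catC.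
  rewrite perm_sym.
  by apply: (H (- k) [:: y]); rewrite ?oppr_eq0 ?mono.
- apply: (H k [::]) => //.
  rewrite big_nil /root_poly !scaled_mxE !sl2mxE !mulr0 !scale0r.
  by rewrite -!mul_polyC mulrN polyCN mulr1; ring.
Qed.

Lemma pt_repP (p : Psl2C) :
  [/\ val p = <[pt_rep p]>%VS, pt_rep p \in sl2C R & pt_rep p != 0].
Proof.
have /andP[psl /eqP pdim] := valP p.
have p0 : pt_rep p != 0.
  by apply/negP; rewrite vpick0 => /eqP p0; move: pdim; rewrite p0 dimv0.
split=> //; last by apply: (subvP psl); exact: memv_pick.
apply/eqP; rewrite eq_sym eqEdim pdim dim_vline p0 andbT.
by rewrite -memvE memv_pick.
Qed.

Fact root_pair_subproof (p : Psl2C) :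
  size (seq_mset (root_seq (pt_rep p))) == 2%N.
Proof.
have [_ psl p0] := pt_repP p.
have [z [w [k [k0 ->]]]] := pair_mx_exists psl p0.
by rewrite (perm_size (perm_eq_seq_mset _)) (perm_size (root_seq_pair z w k0)).
Qed.

(* the identification P(sl_2(C)) = S^2(CP^1) *)
Definition root_pair (p : Psl2C) : S2CP1 :=
  Sub (seq_mset (root_seq (pt_rep p))) (root_pair_subproof p).

Lemma upairP z w z' w' : upair z w = upair z' w' <->
  (z = z' /\ w = w') \/ (z = w' /\ w = z').
Proof.
have C2 (a b : CP1) : perm_eql [:: a; b] [:: b; a].
  by move=> s; rewrite -[[:: a; b]]/([:: a] ++ [:: b]) perm_catC.
split=> [[] /eq_seq_msetP|[[-> ->]//|[-> ->]]]; last first.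
  by apply/val_inj/eq_seq_msetP; rewrite C2.
move=> e; have : z \in [:: z'; w'] by rewrite -(perm_mem e) mem_head.
rewrite !inE => /orP[]/eqP ez; rewrite ez in e *; [left|right]; split=> //.
  move: e; rewrite perm_cons => /perm_mem/(_ w).
  by rewrite !inE eqxx => /esym/eqP.
move: e; rewrite perm_sym C2 perm_cons => /perm_mem/(_ w).
by rewrite !inE eqxx => /eqP.
Qed.

Lemma upair_exists (s : S2CP1) : exists z w, s = upair z w.
Proof.
have := valP s; have := erefl (val s : seq CP1).
case: {1}(val s : seq CP1) => [|z [|w [|? ?]]] e; rewrite -e// => _.
by exists z, w; apply: val_inj; rewrite /= e seq_mset_id.
Qed.

Lemma root_pairP (p : Psl2C) z w :
  root_pair p = upair z w <-> val p = <[pair_mx z w]>%VS.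
Proof.
have [vp psl p0] := pt_repP p.
have [z' [w' [k [k0 e]]]] := pair_mx_exists psl p0.
have line : val p = <[pair_mx z' w']>%VS.
  rewrite vp e; apply/eqP; rewrite eqEdim !dim_vline scaler_eq0 (negbTE k0).
  by rewrite pair_mx_neq0 andbT -memvE memvZ// memv_line.
have -> : root_pair p = upair z' w'.
  by apply/val_inj/eq_seq_msetP; rewrite e; exact: root_seq_pair.
rewrite line; split=> [/upairP[[-> ->]//|[-> ->]]|ee].
  by rewrite pair_mxC.
have /vlineP[l el] : pair_mx z w \in <[pair_mx z' w']>%VS.
  by rewrite ee memv_line.
have l0 : l != 0.
  by apply: contra_neq (pair_mx_neq0 z w) => l0; rewrite el l0 scale0r.
apply/val_inj/eq_seq_msetP; rewrite perm_sym.
apply: perm_trans (root_seq_pair z' w' l0); rewrite perm_sym -el.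
by rewrite -[pair_mx z w]scale1r; apply: root_seq_pair; exact: oner_neq0.
Qed.

Lemma root_pair_bij : bijective root_pair.
Proof.
have ex (s : S2CP1) : exists p : Psl2C, root_pair p == s.
  have [z [w ->]] := upair_exists s.
  have H : (<[pair_mx z w]> <= sl2C R)%VS && (\dim <[pair_mx z w]> == 1%N).
    by rewrite -memvE pair_mx_sl2C dim_vline pair_mx_neq0.
  pose P (l : {vspace 'M[C]_2}) := (l <= sl2C R)%VS && (\dim l == 1%N).
  by exists (exist P _ H); apply/eqP/root_pairP.
have inj : injective root_pair.
  move=> p q e; have [z [w ez]] := upair_exists (root_pair p).
  have pz := ez; rewrite e in ez; apply: val_inj.
  by rewrite (root_pairP p z w).1// (root_pairP q z w).1.
exists (fun s => xchoose (ex s)) => [p|s]; last exact/eqP/(xchooseP (ex s)).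
by apply: inj; exact/eqP/(xchooseP (ex _)).
Qed.

Definition moebius (g : 'M[C]_2) (z : CP1) : CP1 :=
  match z with
  | Some x => if g 1 0 * x + g 1 1 == 0 then None
              else Some ((g 0 0 * x + g 0 1) / (g 1 0 * x + g 1 1))
  | None => if g 1 0 == 0 then None else Some (g 0 0 / g 1 0)
  end.

Let hom (z : CP1) : C * C := if z is Some x then (x, 1) else (1, 0).

Let form (v w : C * C) : 'M[C]_2 :=
  sl2mx ((v.1 * w.2 + w.1 * v.2) / 2) (- (v.1 * w.1)) (v.2 * w.2).

Let pair_mxE z w : pair_mx z w = form (hom z) (hom w).
Proof.
by case: z w => [x|] [y|] /=;
  apply: matrix2P; rewrite !sl2mxE/=; try field.
Qed.

Let det2E (g : 'M[C]_2) : \det g = g 0 0 * g 1 1 - g 0 1 * g 1 0.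
Proof.
rewrite (expand_det_row _ 0) !big_ord_recl big_ord0 addr0
  /cofactor !det_mx11 !mxE /=.
have e1 : lift ord0 ord0 = 1 :> 'I_2 by exact/val_inj.
have e0 : lift (lift ord0 ord0) 0 = 0 :> 'I_2 by exact/val_inj.
by rewrite /= ?e0 ?e1 /= expr0 expr1 mul1r mulN1r mulrN.
Qed.

Let moebius_hom (g : 'M[C]_2) z : \det g = 1 -> exists2 k, k != 0 &
  g 0 0 * (hom z).1 + g 0 1 * (hom z).2 = k * (hom (moebius g z)).1 /\
  g 1 0 * (hom z).1 + g 1 1 * (hom z).2 = k * (hom (moebius g z)).2.
Proof.
rewrite det2E => detg; case: z => [x|] /=.
  case: ifPn => [/eqP e|c0] /=; last first.
    by exists (g 1 0 * x + g 1 1) => //; split; field.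
  exists (g 0 0 * x + g 0 1); last by rewrite !mulr1 mulr0.
  apply/eqP => e'; move/eqP: (oner_neq0 C); apply; rewrite -[LHS]detg.
  transitivity (g 0 0 * (g 1 0 * x + g 1 1) - g 1 0 * (g 0 0 * x + g 0 1)).
    by ring.
  by rewrite e e' !mulr0 subr0.
case: ifPn => [/eqP e|c0] /=; last by exists (g 1 0) => //; split; field.
exists (g 0 0); last by rewrite e !mulr0 !addr0 !mulr1.
apply/eqP => e'; move/eqP: (oner_neq0 C); apply; rewrite -[LHS]detg.
by rewrite e e' mul0r mulr0 subr0.
Qed.

Let mul2E (M N : 'M[C]_2) i j : (M *m N) i j = M i 0 * N 0 j + M i 1 * N 1 j.
Proof.
rewrite mxE !big_ord_recl big_ord0 addr0.
by have -> : lift ord0 ord0 = 1 :> 'I_2 by exact/val_inj.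
Qed.

Lemma root_pair_equivariant (g : 'M[C]_2) (p q : Psl2C) z w : \det g = 1 ->
  val q = <[g *m pt_rep p *m invmx g]>%VS ->
  root_pair p = upair z w -> root_pair q = upair (moebius g z) (moebius g w).
Proof.
move=> detg vq /root_pairP pzw; apply/root_pairP; rewrite vq.
have gu : g \in unitmx by rewrite unitmxE detg unitr1.
have [vp _ p0] := pt_repP p.
have /vlineP[l el] : pt_rep p \in <[pair_mx z w]>%VS.
  by rewrite -pzw vp memv_line.
have l0 : l != 0 by apply: contra_neq p0 => l0; rewrite el l0 scale0r.
have [k1 k10 [e11 e12]] := moebius_hom z detg.
have [k2 k20 [e21 e22]] := moebius_hom w detg.
have conj_form : g *m pair_mx z w *m invmx g =
    (k1 * k2) *: pair_mx (moebius g z) (moebius g w).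
  suff -> : g *m pair_mx z w =
      ((k1 * k2) *: pair_mx (moebius g z) (moebius g w)) *m g by rewrite mulmxK.
  rewrite !pair_mxE.
  have -> : (k1 * k2) *: form (hom (moebius g z)) (hom (moebius g w)) =
      form (g 0 0 * (hom z).1 + g 0 1 * (hom z).2,
            g 1 0 * (hom z).1 + g 1 1 * (hom z).2)
           (g 0 0 * (hom w).1 + g 0 1 * (hom w).2,
            g 1 0 * (hom w).1 + g 1 1 * (hom w).2).
    rewrite e11 e12 e21 e22.
    by apply: matrix2P; rewrite scaled_mxE !sl2mxE/=; field.
  move: detg; rewrite det2E => detg.
  move: (hom z) (hom w) => [x1 y1] [x2 y2].
  transitivity ((g 0 0 * g 1 1 - g 0 1 * g 1 0) *:
    (g *m form (x1, y1) (x2, y2))).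
    by rewrite detg scale1r.
  by apply: matrix2P; rewrite scaled_mxE !mul2E !sl2mxE/=; field.
rewrite el -scalemxAr -scalemxAl conj_form scalerA.
apply/eqP; rewrite eqEdim !dim_vline scaler_eq0 !mulf_eq0.
rewrite (negbTE l0) (negbTE k10) (negbTE k20) pair_mx_neq0 andbT.
by rewrite -memvE memvZ// memv_line.
Qed.

End Roots.

Section Families.
Variable R : realType.
Local Notation C := (R[i]).
Local Notation Re := (@complex.Re R).
Local Notation Im := (@complex.Im R).

Definition same_half_plane (z w : C) : Prop :=
  (0 < Im z /\ 0 < Im w) \/ (Im z < 0 /\ Im w < 0).

Definition opposite_half_planes (z w : C) : Prop :=
  (0 < Im z /\ Im w < 0) \/ (Im z < 0 /\ 0 < Im w).

Definition C1 (f : R -> R) : Prop :=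
  (forall t, derivable f t 1) /\ continuous (f^`())%classic.

(* length of the path t |-> x t + i y t, 0 <= t <= 1, for |dz| / |Im z| *)
Definition poincare_length (x y : R -> R) : R :=
  \int[lebesgue_measure]_(t in `[0, 1])
    (Num.sqrt ((x^`())%classic t ^+ 2 + (y^`())%classic t ^+ 2) / `|y t|).

(* Meaningful for z and w in the same half-plane: the infimum of the lengths of
   the C^1 paths from z to w in that half-plane. *)
Definition hyp_dist (z w : C) : R :=
  inf [set l | exists x y : R -> R,
    [/\ C1 x /\ C1 y,
        Complex (x 0) (y 0) = z /\ Complex (x 1) (y 1) = w,
        forall t, 0 <= t <= 1 -> same_half_plane z (Complex (x t) (y t))
      & l = poincare_length x y]].

Definition familyI (d : R) : set (S2CP1 R) :=
  [set s | exists z w : C,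
    [/\ s = upair (Some z) (Some w), same_half_plane z w & hyp_dist z w = d]].

Definition familyII (d : R) : set (S2CP1 R) :=
  [set s | exists z w : C,
    [/\ s = upair (Some z) (Some w), opposite_half_planes z w,
        z <> conjc w & hyp_dist z (conjc w) = d]].

Definition double_nonreal : set (S2CP1 R) :=
  [set s | exists2 z : C, Im z <> 0 & s = upair (Some z) (Some z)].

Definition real_pairs : set (S2CP1 R) :=
  [set s | exists z w : CP1 R, s = upair z w /\
    ((RP1 z /\ RP1 w) \/ z = CP1_conj w)].

Definition one_real_pairs : set (S2CP1 R) :=
  [set s | exists z w : CP1 R, [/\ s = upair z w, RP1 z & ~ RP1 w]].

End Families.

(* Main.v *)
From HB Require Import structures.
Require Import Defs.
From mathcomp Require Import all_boot all_order all_algebra.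
From mathcomp Require Import complex ring lra.
From mathcomp Require Import all_classical all_reals all_analysis.

(** The proof replaces the orbits by level sets of an explicit invariant.

    The Killing form gives two functions of a traceless complex matrix L, the
    quadratic form q(L) = tr (L L) / 2 and the hermitian form
    h(L) = tr (L conj L).  An automorphism of SL2(R)
    differentiates to a linear map A of sl2(R) that preserves brackets, and
    ad X cubed is -4 (det X) ad X, so A preserves the determinant
    ([lie_autP]).  Since h(L) and |q(L)|^2 are polynomials in the determinants of
    the real part, the imaginary part and their sum, the ratio h / |q| is
    constant on orbits.  Conversely all conjugations by elements of GL2(R) are
    automorphisms, and GL2(R) acts transitively on the pairs of points with a
    given invariant: every pair of non-real points (z, w) is the image of
    (i, i t) for exactly one real t with |t| >= 1 ([normal_pair_exists],
    [normal_pair_unique]).  The pairs in one half-plane are those with t > 0,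
    complex conjugate pairs are those with t = -1, and in terms of roots the
    invariant is |z - w|^2 / (Im z Im w) = (t - 1)^2 / t.  Hence the regular
    orbits are indexed by the t in [1, oo) and in (-oo, -1)
    ([root_pair_orbit]).

    The hyperbolic distance of i and i t is ln t, and it is invariant under the
    real Moebius group.  Both facts come together in [hyp_dist_normal_pair]: the
    logarithm of the imaginary part of the pulled back path has a gradient of
    hyperbolic norm one, so it bounds the length of every path from below, and
    the image of the vertical segment attains the bound.  So the distance d and
    the parameter t are related by t = exp d in family I and t = - exp d in
    family II.

    L is regular exactly when the Gram determinant h^2 - 4 |q|^2 of L and its
    conjugate does not vanish; in terms of the roots this determinant is
    4 Im z Im w |z - conj w|^2 up to a positive factor.  That a non-real L is
    degenerate only if it has a real root follows from a resultant: if the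
    bracket of L and conj L lies in their span, their root polynomials have a
    common root ([closed_common_root]).

    In each affine chart an orbit is locally cut out by polynomials: by the real
    and imaginary parts of q when t = 1, and otherwise by the single equation
    (t - 1)^4 h^2 = 4 (t^2 + 6 t + 1)^2 |q|^2, or by h = 0 when
    t^2 + 6 t + 1 = 0.  The differentials of these equations are independent
    along the orbit, which gives the dimensions 2 and 3. *)

Set Implicit Arguments.
Unset Strict Implicit.
Unset Printing Implicit Defensive.

Import Order.TTheory GRing.Theory Num.Theory.
Import numFieldNormedType.Exports.

Local Open Scope classical_set_scope.
Local Open Scope ring_scope.

(** * Two by two matrices *)

Section TwoByTwo.

Lemma ord2P (P : 'I_2 -> Prop) : P 0 -> P 1 -> forall i, P i.
Proof.
move=> P0 P1 [[|[|//]] lt_i2].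
- by rewrite (_ : Ordinal lt_i2 = 0)//; exact/val_inj.
- by rewrite (_ : Ordinal lt_i2 = 1)//; exact/val_inj.
Qed.

Lemma mx2P (T : Type) (L M : 'M[T]_2) :
  L 0 0 = M 0 0 -> L 0 1 = M 0 1 -> L 1 0 = M 1 0 -> L 1 1 = M 1 1 -> L = M.
Proof.
by move=> ? ? ? ?; apply/matrixP; apply: ord2P; apply: ord2P.
Qed.

Lemma mulmx2E (T : pzRingType) (M N : 'M[T]_2) i j :
  (M *m N) i j = M i 0 * N 0 j + M i 1 * N 1 j.
Proof.
rewrite mxE !big_ord_recl big_ord0 addr0.
by have -> : lift ord0 ord0 = 1 :> 'I_2 by exact/val_inj.
Qed.

Lemma det2E (T : comPzRingType) (g : 'M[T]_2) :
  \det g = g 0 0 * g 1 1 - g 0 1 * g 1 0.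
Proof.
rewrite (expand_det_row _ 0) !big_ord_recl big_ord0 addr0.
rewrite /cofactor !det_mx11 !mxE /=.
have e1 : lift ord0 ord0 = 1 :> 'I_2 by exact/val_inj.
have e0 : lift (lift ord0 ord0) 0 = 0 :> 'I_2 by exact/val_inj.
by rewrite /= ?e0 ?e1 /= expr0 expr1 mul1r mulN1r mulrN.
Qed.

Lemma mxtrace2E (T : pzSemiRingType) (M : 'M[T]_2) : \tr M = M 0 0 + M 1 1.
Proof.
rewrite /mxtrace !big_ord_recl big_ord0 addr0.
by have -> : lift ord0 ord0 = 1 :> 'I_2 by exact/val_inj.
Qed.

Lemma mxtrace2_eq0 (T : pzRingType) (M : 'M[T]_2) :
  (\tr M = 0) <-> (M 1 1 = - M 0 0).
Proof.
rewrite mxtrace2E; split=> [/eqP|->]; last by rewrite subrr.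
by rewrite addrC addr_eq0 => /eqP.
Qed.

Definition mx2 (T : Type) (a b c d : T) : 'M[T]_2 :=
  \matrix_(i, j) if i == 0 then if j == 0 then a else b
                 else if j == 0 then c else d.

Lemma mx2E (T : Type) (a b c d : T) : (mx2 a b c d 0 0 = a) *
  (mx2 a b c d 0 1 = b) * (mx2 a b c d 1 0 = c) * (mx2 a b c d 1 1 = d).
Proof. by rewrite !mxE. Qed.

End TwoByTwo.

(** * Automorphisms of SL2(R) and their differentials *)

Section Lie.
Variable R : realType.
Implicit Types (X Y : 'M[R]_2) (phi : 'M[R]_2 -> 'M[R]_2).

Lemma is_derive_mxP m n (M : R -> 'M[R]_(m.+1, n.+1)) (D : 'M[R]_(m.+1, n.+1))
    (t : R) :
  is_derive t 1 M D <-> forall i j, is_derive t 1 (fun x => M x i j) (D i j).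
Proof.
split=> [[Md <-] i j|h].
  have := (derivable_mxP _ _ _).1 Md i j => Mij.
  by apply: DeriveDef => //; rewrite derive_mx// mxE.
have Md : derivable M t 1 by apply/derivable_mxP => i j; case: (h i j).
apply: DeriveDef => //; rewrite derive_mx//; apply/matrixP => i j; rewrite mxE.
by case: (h i j).
Qed.

Lemma is_derive_ext (V W : normedModType R) (f g : V -> W) (x v : V) (d d' : W) :
  is_derive x v f d -> f =1 g -> d = d' -> is_derive x v g d'.
Proof. by move=> fd /funext <- <-. Qed.

Lemma is_derive_mulmx (M N : R -> 'M[R]_2) (DM DN : 'M[R]_2) (t : R) :
  is_derive t 1 M DM -> is_derive t 1 N DN ->
  is_derive t 1 (fun s => M s *m N s) (DM *m N t + M t *m DN).
Proof.
move=> /is_derive_mxP dM /is_derive_mxP dN; apply/is_derive_mxP => i j.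
apply: (is_derive_ext (is_deriveD (is_deriveM (dM i 0) (dN 0 j))
  (is_deriveM (dM i 1) (dN 1 j)))) => [s|]; first by rewrite mulmx2E.
by rewrite mxE !mulmx2E /= /GRing.scale /=; ring.
Qed.

Lemma is_derive_unique (V : normedModType R) (f : R -> V) (t : R) D D' :
  is_derive t 1 f D -> is_derive t 1 f D' -> D = D'.
Proof. by move=> [_ <-] [_ <-]. Qed.

Definition curve_at1 (gamma : R -> 'M[R]_2) X :=
  [/\ forall t, SL2 (gamma t), gamma 0 = 1%:M & is_derive (0 : R) 1 gamma X].

Lemma SL2_unit (g : 'M[R]_2) : SL2 g -> g \in unitmx.
Proof. by rewrite /SL2/= unitmxE => ->; rewrite unitr1. Qed.

Lemma SL2_mul (g h : 'M[R]_2) : SL2 g -> SL2 h -> SL2 (g *m h).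
Proof. by rewrite /SL2/= det_mulmx => -> ->; rewrite mulr1. Qed.

Lemma SL2_1 : @SL2 R 1%:M. Proof. exact: det1. Qed.

Lemma curve_trace gamma X : curve_at1 gamma X -> \tr X = 0.
Proof.
move=> [g1 g0 /is_derive_mxP dg].
have := dg 0 0; have := dg 0 1; have := dg 1 0; have := dg 1 1 => d11 d10 d01 d00.
have h : is_derive (0 : R) 1 ((fun s => gamma s 0 0) * (fun s => gamma s 1 1) -
   (fun s => gamma s 0 1) * (fun s => gamma s 1 0)) (\tr X).
  apply: is_derive_ext (is_deriveB (is_deriveM d00 d11) (is_deriveM d01 d10)) _ _.
    by [].
  by rewrite g0 !mxE mxtrace2E /= /GRing.scale /=; ring.
move: h; rewrite (_ : _ - _ = cst 1); last first.
  by apply/funext => s; have := g1 s; rewrite /SL2 /= det2E.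
by move=> h; apply: is_derive_unique h _; exact: is_derive_cst.
Qed.

Lemma is_derive_lin0 (k : R) : is_derive (0 : R) 1 (fun t : R => k * t) k.
Proof.
apply: (is_derive_ext (is_deriveZ k (is_derive_id (0 : R) 1))) => //.
by rewrite /GRing.scale /= mulr1.
Qed.

Lemma is_derive_exp0 (k : R) : is_derive (0 : R) 1 (fun t : R => expR (k * t)) k.
Proof.
rewrite (_ : (fun _ => _) = expR \o (fun t : R => k * t)); last by apply/funext.
have := is_derive_lin0 k => ?.
by apply: is_derive_eq; rewrite mulr0 expR0 mul1r.
Qed.

Lemma is_derive_mx2 (f1 f2 f3 f4 : R -> R) (d1 d2 d3 d4 t : R) :
  is_derive t 1 f1 d1 -> is_derive t 1 f2 d2 -> is_derive t 1 f3 d3 ->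
  is_derive t 1 f4 d4 ->
  is_derive t 1 (fun s => mx2 (f1 s) (f2 s) (f3 s) (f4 s)) (mx2 d1 d2 d3 d4).
Proof.
move=> h1 h2 h3 h4; apply/is_derive_mxP; apply: ord2P; apply: ord2P;
  rewrite mx2E;
  by under eq_fun do rewrite mx2E.
Qed.

(** A curve defined for all times is needed, so 1 + t X would not do: the one
    below is the product of the unipotent one-parameter groups of the two
    off-diagonal entries and of the diagonal one-parameter group. *)
Lemma curve_exists X : \tr X = 0 -> exists gamma, curve_at1 gamma X.
Proof.
move=> /mxtrace2_eq0 trX.
have [a [b [c ->]]] : exists a b c, X = mx2 a b c (- a).
  by exists (X 0 0), (X 0 1), (X 1 0); apply: mx2P; rewrite !mx2E.
have la := is_derive_lin0 a; have lb := is_derive_lin0 b.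
have lc := is_derive_lin0 c.
have ea := is_derive_exp0 a; have ena := is_derive_exp0 (- a).
exists (fun t => mx2 (expR (a * t) * (1 + (b * t) * (c * t)))
  (expR (- a * t) * (b * t)) (expR (a * t) * (c * t)) (expR (- a * t))).
split.
- move=> t; rewrite /SL2 /= det2E !mx2E.
  set u := expR (a * t); set v := expR (- a * t).
  have uv : u * v = 1 by rewrite /u /v -expRD mulNr subrr expR0.
  transitivity (u * v); last by [].
  by ring.
- by apply: mx2P; rewrite !mx2E !mulr0 ?expR0 !mxE/= ?mulr0 ?addr0 ?mulr1.
apply: is_derive_mx2 => //.
- apply: (is_derive_ext (is_deriveM ea
    (is_deriveD (is_derive_cst (1 : R) _ _) (is_deriveM lb lc)))) => //.
  by rewrite !fctE /= /GRing.scale /= !mulr0 !expR0; ring.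
- apply: (is_derive_ext (is_deriveM ena lb)) => //.
  by rewrite /GRing.scale /= !mulr0 !expR0; ring.
- apply: (is_derive_ext (is_deriveM ea lc)) => //.
  by rewrite /GRing.scale /= !mulr0 !expR0; ring.
Qed.
Lemma is_derive_comp_curve (V W : normedModType R) (f : V -> W) (c : R -> V)
    (v : V) (t : R) :
  differentiable f (c t) -> is_derive t 1 c v ->
  is_derive t 1 (f \o c) ('d f (c t) v).
Proof.
move=> df [dc <-]; have {}dc : differentiable c t by exact/derivable1_diffP.
have dfc : differentiable (f \o c) t by exact: differentiable_comp.
apply: DeriveDef; first exact: diff_derivable.
by rewrite (deriveE _ dfc) (deriveE _ dc) diff_comp.
Qed.

Definition SL2_hom phi :=
  [/\ forall g, SL2 g -> SL2 (phi g),
      forall g h, SL2 g -> SL2 h -> phi (g *m h) = phi g *m phi h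
    & smooth_subset (@SL2 R) phi].

Lemma SL2_hom1 phi : SL2_hom phi -> phi 1%:M = 1%:M.
Proof.
move=> [stab morph _]; have u := SL2_unit (stab _ SL2_1).
apply: (can_inj (mulKmx u)); rewrite -morph ?mulmx1//; exact: SL2_1.
Qed.

(** The differential of the local smooth extension of phi at 1 is a linear map
    on all matrices; phi and its extension agree along curves in SL2(R), so it
    computes the velocities of their images. *)
Lemma SL2_hom_differential phi : SL2_hom phi ->
  exists2 A : {linear 'M[R]_2 -> 'M[R]_2}, continuous A & forall gamma X,
    curve_at1 gamma X -> curve_at1 (phi \o gamma) (A X).
Proof.
move=> hom; have [stab morph smooth] := hom.
have [U [F [oU U1 sF FE]]] := smooth _ SL2_1.
have dF : differentiable F (1%:M : 'M[R]_2) by have [h _] := sF 1%N; exact: h.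
exists ('d F (1%:M : 'M[R]_2)) => [|gamma X [g1 g0 dg]].
  exact: diff_continuous.
split=> [t||]; first exact: stab; first by rewrite /= g0 SL2_hom1.
have dgam : differentiable gamma (0 : R) by apply/derivable1_diffP; case: dg.
have e : \forall t \near (0 : R), (F \o gamma) t = (phi \o gamma) t.
  have := differentiable_continuous dgam => cg.
  have : \forall t \near (0 : R), U (gamma t).
    by apply: cg; rewrite g0; apply: open_nbhs_nbhs.
  by apply: filterS => t Ut /=; apply: FE.
apply: near_eq_is_derive e _.
by rewrite -g0; apply: is_derive_comp_curve; rewrite ?g0.
Qed.

Definition comm2 (T : pzRingType) (X Y : 'M[T]_2) := X *m Y - Y *m X.

Lemma SL2_inv (g : 'M[R]_2) : SL2 g -> SL2 (invmx g).
Proof. by rewrite /SL2/= det_inv => ->; rewrite invr1. Qed.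

Lemma SL2_invE (g : 'M[R]_2) : SL2 g ->
  invmx g = mx2 (g 1 1) (- g 0 1) (- g 1 0) (g 0 0).
Proof.
move=> sg; have := sg; rewrite /SL2/= det2E => dg.
apply: (can_inj (mulKmx (SL2_unit sg))); rewrite mulmxV ?SL2_unit//.
by apply: mx2P; rewrite mulmx2E !mx2E !mxE/= -?dg; ring.
Qed.

Lemma curve_inv gamma X :
  curve_at1 gamma X -> curve_at1 (fun t => invmx (gamma t)) (- X).
Proof.
move=> cg; have trX := curve_trace cg; have [g1 g0 dg] := cg.
split=> [t||]; first exact: SL2_inv; first by rewrite g0 invmx1.
move/is_derive_mxP : dg => dg.
have := is_derive_mx2 (dg 1 1) (is_deriveN (dg 0 1)) (is_deriveN (dg 1 0)) (dg 0 0).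
move=> h; apply: is_derive_ext h _ _ => [t|]; first by rewrite SL2_invE.
move/mxtrace2_eq0 : trX => trX.
by apply: mx2P; rewrite !mx2E !mxE ?trX ?opprK.
Qed.

(** Differentiating phi (g k g^-1) = phi g phi k (phi g)^-1 in k, then in g. *)
Lemma SL2_hom_bracket phi (A : {linear 'M[R]_2 -> 'M[R]_2}) :
  SL2_hom phi -> continuous A ->
  (forall gamma X, curve_at1 gamma X -> curve_at1 (phi \o gamma) (A X)) ->
  forall X Y, \tr X = 0 -> \tr Y = 0 -> A (comm2 Y X) = comm2 (A Y) (A X).
Proof.
move=> hom cA dA X Y trX trY; have [stab morph _] := hom.
have [gX cX] := curve_exists trX; have [gY cY] := curve_exists trY.
have [X1 X0 dX] := cX; have [Y1 Y0 dY] := cY.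
have [_ _ dYi] := curve_inv cY.
(* The first derivative, in the conjugated variable. *)
have Ad g : SL2 g ->
    A (g *m X *m invmx g) = phi g *m A X *m phi (invmx g).
  move=> sg.
  have c1 : curve_at1 (fun t => g *m gX t *m invmx g) (g *m X *m invmx g).
    split=> [t||]; first by do 2?apply: SL2_mul => //; exact: SL2_inv.
      by rewrite X0 mulmx1 mulmxV// SL2_unit.
    have := is_derive_mulmx (is_derive_mulmx (is_derive_cst g (0 : R) 1) dX)
      (is_derive_cst (invmx g) (0 : R) 1).
    by move=> h; apply: is_derive_ext h _ _ => //; rewrite mul0mx mulmx0 addr0 add0r.
  have [_ _ d1] := dA _ _ c1; have [_ _ d2] := dA _ _ cX.
  apply: is_derive_unique d1 _.
  have := is_derive_mulmx (is_derive_mulmx (is_derive_cst (phi g) (0 : R) 1) d2)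
    (is_derive_cst (phi (invmx g)) (0 : R) 1).
  move=> h; apply: is_derive_ext h _ _ => [t|] /=.
    rewrite !morph//; [exact: SL2_mul|exact: SL2_inv].
  by rewrite mul0mx mulmx0 addr0 add0r.
have [_ _ dAY] := dA _ _ cY; have [_ _ dAYi] := dA _ _ (curve_inv cY).
(* The second derivative, in the conjugating variable. *)
have d1 := is_derive_mulmx (is_derive_mulmx dAY (is_derive_cst (A X) (0 : R) 1)) dAYi.
have d2 := is_derive_mulmx (is_derive_mulmx dY (is_derive_cst X (0 : R) 1)) dYi.
have dAlin (f : R -> 'M[R]_2) D : is_derive (0 : R) 1 f D ->
    is_derive (0 : R) 1 (A \o f) (A D).
  move=> df; rewrite (_ : A D = 'd A (f 0) D); last by rewrite diff_lin.
  by apply: is_derive_comp_curve => //; exact: linear_differentiable.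
have d3 := dAlin _ _ d2.
have /(is_derive_unique d3) : is_derive (0 : R) 1
    (A \o (fun t => gY t *m X *m invmx (gY t))) (comm2 (A Y) (A X)).
  apply: is_derive_ext d1 _ _ => [t|] /=; first by rewrite Ad.
  by rewrite /comm2 Y0 invmx1 SL2_hom1// mulmx0 addr0 mul1mx mulmx1 raddfN mulmxN.
by rewrite Y0 invmx1 mulmx0 addr0 mul1mx mulmx1 mulmxN.
Qed.
Lemma comm2E (T : pzRingType) (X Y : 'M[T]_2) i j : comm2 X Y i j =
  X i 0 * Y 0 j + X i 1 * Y 1 j - (Y i 0 * X 0 j + Y i 1 * X 1 j).
Proof. by rewrite /comm2 !mxE -!mulmx2E !mxE. Qed.

(** For traceless X the square of X is the scalar - det X.  This identity lets
    the bracket determine the determinant. *)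
Lemma bracket_cubed (T : comPzRingType) (X Y : 'M[T]_2) : \tr X = 0 ->
  comm2 X (comm2 X (comm2 X Y)) = (- 4 * \det X) *: comm2 X Y.
Proof.
move=> /mxtrace2_eq0 trX; rewrite det2E.
by apply: mx2P; rewrite [RHS]mxE !comm2E trX; ring.
Qed.

Lemma comm2_trace (T : comPzRingType) (X Y : 'M[T]_2) : \tr (comm2 X Y) = 0.
Proof. by rewrite /comm2 raddfB /= mxtrace_mulC subrr. Qed.

Lemma comm2_nonzero X : \tr X = 0 -> X != 0 ->
  exists2 Y, \tr Y = 0 & comm2 X Y != 0.
Proof.
move=> /mxtrace2_eq0 trX X0; apply: contrapT => noY.
have cX a b c : comm2 X (mx2 a b c (- a)) = 0.
  apply/eqP; apply: contrapT => /negP h; apply: noY.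
  by exists (mx2 a b c (- a)) => //; apply/mxtrace2_eq0; rewrite !mx2E.
move/negP: X0; apply; apply/eqP.
have e1 := cX 1 0 0; have e2 := cX 0 1 0.
have h1 := congr1 (fun M : 'M[R]_2 => M 0 1) e1.
have h2 := congr1 (fun M : 'M[R]_2 => M 1 0) e1.
have h3 := congr1 (fun M : 'M[R]_2 => M 0 1) e2.
move: h1 h2 h3; rewrite !comm2E !mx2E !mxE /= => h1 h2 h3.
by apply: mx2P; rewrite ?trX ?mxE; lra.
Qed.

(** The determinant, that is the Killing form up to a factor, is preserved
    because [bracket_cubed] holds for X as well as for its image. *)
Lemma lie_autP phi : lie_aut phi ->
  exists A : {linear 'M[R]_2 -> 'M[R]_2}, forall X, \tr X = 0 ->
    [/\ lie_diff phi X = A X, \tr (A X) = 0, A X = 0 -> X = 0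
      & \det (A X) = \det X].
Proof.
move=> [psi [[phiS psiS] phiM [phiK psiK] smphi smpsi]].
have hphi : SL2_hom phi by split.
have hpsi : SL2_hom psi.
  split=> // g h sg sh; have sg' := psiS _ sg; have sh' := psiS _ sh.
  by rewrite -{1}(psiK g)// -{1}(psiK h)// -phiM// phiK//; exact: SL2_mul.
have [A cA dA] := SL2_hom_differential hphi.
have [B cB dB] := SL2_hom_differential hpsi.
have trA X : \tr X = 0 -> \tr (A X) = 0.
  by move=> /curve_exists[g /dA/curve_trace].
have BA X : \tr X = 0 -> B (A X) = X.
  move=> /curve_exists[g cg]; have [g1 _ dg] := cg.
  have [_ _ d] := dB _ _ (dA _ _ cg).
  apply: is_derive_unique d _; apply: is_derive_ext dg _ _ => // t /=.
  by rewrite phiK.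
have injA X : \tr X = 0 -> A X = 0 -> X = 0.
  by move=> trX AX0; rewrite -(BA X)// AX0 raddf0.
exists A => X trX; split.
- apply: xget_unique => [gamma g1 g0 dg|Y hY].
    by have [] := dA gamma X _.
  have [g cg] := curve_exists trX; have [g1 g0 dg] := cg.
  by have [_ _ d] := dA _ _ cg; apply: is_derive_unique d; exact: hY.
- exact: trA.
- exact: injA.
have [->|X0] := eqVneq X 0; first by rewrite raddf0.
have [Y trY XY0] := comm2_nonzero trX X0.
have br Y1 Y2 : \tr Y1 = 0 -> \tr Y2 = 0 -> A (comm2 Y1 Y2) = comm2 (A Y1) (A Y2).
  by move=> tr1 tr2; exact: (SL2_hom_bracket hphi cA dA tr2 tr1).
have AXY0 : A (comm2 X Y) != 0.
  by apply: contra_neq XY0 => h; apply: injA => //; exact: comm2_trace.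
have := bracket_cubed Y trX; move/(congr1 A).
rewrite linearZ !br ?comm2_trace// bracket_cubed ?trA// => /eqP.
rewrite -subr_eq0 -scalerBl -br// scaler_eq0 (negbTE AXY0) orbF.
by rewrite -mulrBr mulf_eq0 oppr_eq0 pnatr_eq0 /= subr_eq0 => /eqP.
Qed.

(** Through the expansion in the basis of elementary matrices. *)
Lemma linear_mx_continuous m n (W : normedModType R)
  (f : {linear 'M[R]_(m.+1, n.+1) -> W}) : continuous f.
Proof.
move=> x; apply: differentiable_continuous.
have -> : (f : _ -> _) = \sum_(i < m.+1) \sum_(j < n.+1)
    (fun M : 'M[R]_(m.+1, n.+1) => (M i j : R) *: f (delta_mx i j)).
  apply/funext => M; rewrite [in LHS](matrix_sum_delta M) raddf_sum fct_sumE.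
  apply: eq_bigr => i _; rewrite raddf_sum fct_sumE.
  by apply: eq_bigr => j _; exact: linearZZ.
apply: differentiable_sum => i; apply: differentiable_sum => j.
by apply: differentiableZl; exact: differentiable_coord.
Qed.

Lemma Ck_cst (V W : normedModType R) (U : set V) k (w : W) : Ck k U (cst w).
Proof.
elim: k w => [|k IH] w /=; first by move=> x _; exact: cst_continuous.
split=> [x _|v]; first exact: differentiable_cst.
rewrite (_ : (fun _ => _) = cst 0); first exact: IH.
by apply/funext => x; rewrite derive_cst.
Qed.

Lemma smooth_linear (V W : normedModType R) (U : set V) (f : {linear V -> W}) :
  continuous f -> smooth_on U f.
Proof.
move=> cf [|k] /=; first by move=> x _; exact: cf.
have df x : differentiable f x by exact: linear_differentiable.
split=> // v; rewrite (_ : (fun _ => _) = cst (f v)); first exact: Ck_cst.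
by apply/funext => x; rewrite deriveE// diff_lin.
Qed.

Definition conj2 (T : comUnitRingType) (h X : 'M[T]_2) := h *m X *m invmx h.

Lemma conj2_is_linear (h : 'M[R]_2) : linear (conj2 h).
Proof. by move=> k X Y; rewrite /conj2 mulmxDr mulmxDl -scalemxAr -scalemxAl. Qed.

HB.instance Definition _ (h : 'M[R]_2) :=
  GRing.isLinear.Build R 'M[R]_2 'M[R]_2 _ (conj2 h) (conj2_is_linear h).

(** Matrices of negative determinant are included: they give the outer
    automorphisms. *)
Lemma lie_aut_conj (h : 'M[R]_2) : h \in unitmx -> lie_aut (conj2 h).
Proof.
have det_conj (g k : 'M[R]_2) : g \in unitmx -> SL2 k -> SL2 (conj2 g k).
  rewrite /SL2/= /conj2 !det_mulmx det_inv => gu ->.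
  by rewrite mulr1 divrr// -unitmxE.
have smooth (g : 'M[R]_2) : smooth_subset (@SL2 R) (conj2 g).
  move=> x _; exists setT, (conj2 g); split=> //; first exact: openT.
  exact/smooth_linear/linear_mx_continuous.
move=> hu; have hiu : invmx h \in unitmx by rewrite unitmx_inv.
exists (conj2 (invmx h)); split=> //.
- by split=> g sg; exact: det_conj.
- by move=> g k _ _; rewrite /conj2 !mulmxA mulmxKV.
- by split=> g _; rewrite /conj2 invmxK !mulmxA ?mulVmx ?mulmxV// mul1mx ?mulmxKV ?mulmxK.
Qed.

Lemma lie_diff_conj (h X : 'M[R]_2) : h \in unitmx -> \tr X = 0 ->
  lie_diff (conj2 h) X = conj2 h X.
Proof.
move=> hu trX.
have d (g : R -> 'M[R]_2) : is_derive (0 : R) 1 g X ->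
    is_derive (0 : R) 1 (conj2 h \o g) (conj2 h X).
  move=> dg.
  apply: is_derive_ext (is_derive_mulmx
    (is_derive_mulmx (is_derive_cst h (0 : R) 1) dg)
    (is_derive_cst (invmx h) (0 : R) 1)) _ _ => //.
  by rewrite mul0mx mulmx0 addr0 add0r.
apply: xget_unique => [gamma _ _|Y hY]; first exact: d.
have [g [g1 g0 dg]] := curve_exists trX.
by apply: (is_derive_unique (hY _ g1 g0 dg)); exact: d.
Qed.
End Lie.

(** * The normal form of a pair of non-real points *)

Section NormalForm.
Variable R : realType.
Local Notation C := (R[i]).
Local Notation Re := (@complex.Re R).
Local Notation Im := (@complex.Im R).

(** The Moebius map of the matrix (a b; c d) sends i s to z: the equation
    z (c i s + d) = a i s + b in real coordinates. *)
Definition moves (a b c d s : R) (z : C) : Prop :=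
  Re z * d - Im z * (c * s) = b /\ Re z * (c * s) + Im z * d = a * s.

(** The pair (z, w) is the image of (i, i t) under an element of GL2(R). *)
Definition normal_pair (z w : C) (t : R) : Prop :=
  exists a b c d : R,
    [/\ a * d - b * c != 0, moves a b c d 1 z & moves a b c d t w].

Implicit Types (a b c d s t : R) (z w : C).

Lemma moves_Im a b c d s z : moves a b c d s z ->
  Im z * (d ^+ 2 + (c * s) ^+ 2) = (a * d - b * c) * s.
Proof. by move=> [h1 h2]; rewrite -h1 mulrBl mulrAC -h2; ring. Qed.

Lemma moves_Re a b c d s z : moves a b c d s z ->
  Re z * (d ^+ 2 + (c * s) ^+ 2) = b * d + a * s * (c * s).
Proof. by move=> [h1 h2]; rewrite -h1 -h2; ring. Qed.

Lemma moves_denom a b c d s z : moves a b c d s z -> a * d - b * c != 0 ->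
  s != 0 -> 0 < d ^+ 2 + (c * s) ^+ 2.
Proof.
move=> h D0 s0; rewrite lt_def addr_ge0 ?sqr_ge0// andbT.
by apply: contra_neq (mulf_neq0 D0 s0) => e; rewrite -(moves_Im h) e mulr0.
Qed.

(** The imaginary part of the preimage of z is det g Im z / |a - c z|^2. *)
Lemma moves_pullback a b c d s z : s != 0 -> moves a b c d s z ->
  s * ((a - c * Re z) ^+ 2 + c ^+ 2 * Im z ^+ 2) = (a * d - b * c) * Im z.
Proof.
move=> s0 h; have e := moves_Im h; case: h => h1 h2.
apply: (mulfI s0).
transitivity ((a * s - Re z * (c * s)) ^+ 2 + (Im z * (c * s)) ^+ 2); first by ring.
transitivity (Im z * (Im z * (d ^+ 2 + (c * s) ^+ 2))); last by rewrite e; ring.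
by rewrite -h2; ring.
Qed.

Lemma moves_rescale a b c d s s' z :
  moves a b c d (s * s') z -> moves (a * s) b (c * s) d s' z.
Proof. by move=> [h1 h2]; split; rewrite -!mulrA. Qed.

(** Precomposition with the inversion sending i s to i / s. *)
Lemma moves_invert a b c d s z : s != 0 ->
  moves a b c d s z -> moves b (- a) d (- c) s^-1 z.
Proof.
move=> s0 [h1 h2]; split.
- apply: (mulfI s0); rewrite [RHS]mulrN -[s * a]mulrC -h2; field.
  exact: s0.
- by rewrite -h1; field.
Qed.

(** Precomposition with the reflection exchanging i s and - i s. *)
Lemma moves_flip a b c d s z :
  moves a b c d s z -> moves (- a) b (- c) d (- s) z.
Proof. by move=> [h1 h2]; split; rewrite !mulrNN. Qed.

Lemma moves_conj a b c d s z :
  moves a b c d s z -> moves a b c d (- s) (conjc z).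
Proof.
case: z => x y [/= h1 h2]; split => /=;
  [rewrite -h1|rewrite [RHS]mulrN -h2]; ring.
Qed.

Lemma conjcE (z : C) : (Re (conjc z) = Re z) * (Im (conjc z) = - Im z).
Proof. by case: z. Qed.

(** If the real parts differ, m is the centre and r the radius of the geodesic
    through z and w.  The map sending m - r to 0 and m + r to infinity carries
    this half-circle to the imaginary axis; its inverse is the matrix used. *)
Lemma upper_moves z w : 0 < Im z -> 0 < Im w -> exists a b c d s s',
  [/\ 0 < s, 0 < s', a * d - b * c != 0, moves a b c d s z & moves a b c d s' w].
Proof.
case: z w => [x y] [u v] /= y0 v0; have [<-|xu] := eqVneq x u.
  exists 1, x, 0, 1, y, v; split=> //; first by rewrite !mulr1 mulr0 subr0 oner_neq0.
  - by split=> /=; ring.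
  - by split=> /=; ring.
pose m := (x ^+ 2 + y ^+ 2 - u ^+ 2 - v ^+ 2) / (2 * (x - u)).
pose r := Num.sqrt ((x - m) ^+ 2 + y ^+ 2).
have r2 : r ^+ 2 = (x - m) ^+ 2 + y ^+ 2.
  by rewrite sqr_sqrtr// addr_ge0// sqr_ge0.
have r2' : r ^+ 2 = (u - m) ^+ 2 + v ^+ 2.
  rewrite r2; apply/eqP; rewrite -subr_eq0; apply/eqP.
  transitivity (x ^+ 2 + y ^+ 2 - u ^+ 2 - v ^+ 2 - 2 * (x - u) * m); first by ring.
  by rewrite /m; field; rewrite subr_eq0.
have r0 : 0 < r by rewrite sqrtr_gt0 ltr_wpDl ?sqr_ge0// exprn_gt0.
have rx p q : r ^+ 2 = (p - m) ^+ 2 + q ^+ 2 -> 0 < q -> 0 < m + r - p.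
  by move=> h q0; nra.
have rx1 := rx _ _ r2 y0; have rx2 := rx _ _ r2' v0.
exists (m + r), (m - r), 1, 1, (y / (m + r - x)), (v / (m + r - u)).
split; rewrite ?divr_gt0//.
- by rewrite !mulr1; lra.
- split=> /=.
  + apply/eqP; rewrite -subr_eq0 -(mulrI_eq0 _ (lregP (lt0r_neq0 rx1))); apply/eqP.
    transitivity ((m + r - x) * (x - m + r) - y ^+ 2).
      by field; apply: lt0r_neq0.
    by transitivity (r ^+ 2 - (x - m) ^+ 2 - y ^+ 2); [ring|rewrite r2; ring].
  + by field; apply: lt0r_neq0.
- split=> /=.
  + apply/eqP; rewrite -subr_eq0 -(mulrI_eq0 _ (lregP (lt0r_neq0 rx2))); apply/eqP.
    transitivity ((m + r - u) * (u - m + r) - v ^+ 2).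
      by field; apply: lt0r_neq0.
    by transitivity (r ^+ 2 - (u - m) ^+ 2 - v ^+ 2); [ring|rewrite r2'; ring].
  + by field; apply: lt0r_neq0.
Qed.

(** After rescaling, the points lie over i and i t with t > 0; an inversion
    brings t to [1, oo). *)
Lemma upper_normal_pair z w : 0 < Im z -> 0 < Im w ->
  exists2 t, 1 <= t & normal_pair z w t.
Proof.
move=> z0 w0; have [a [b [c [d [s [s' [sp s'p D0 mz mw]]]]]]] := upper_moves z0 w0.
have s0 := lt0r_neq0 sp.
have mz1 : moves (a * s) b (c * s) d 1 z by apply: moves_rescale; rewrite mulr1.
have mw1 : moves (a * s) b (c * s) d (s' / s) w.
  by apply: moves_rescale; rewrite mulrCA mulfV// mulr1.
have D1 : a * s * d - b * (c * s) != 0.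
  by rewrite (_ : _ - _ = (a * d - b * c) * s) ?mulf_neq0//; ring.
have [t1|t1] := leP 1 (s' / s).
  by exists (s' / s) => //; exists (a * s), b, (c * s), d.
exists (s' / s)^-1; first by rewrite invf_ge1 ?divr_gt0// ltW.
exists b, (- (a * s)), d, (- (c * s)); split.
- by rewrite (_ : _ - _ = a * s * d - b * (c * s))//; ring.
- by have := moves_invert (oner_neq0 R) mz1; rewrite invr1.
- by apply: moves_invert => //; rewrite lt0r_neq0// divr_gt0.
Qed.

Lemma normal_pair_conjr z w t : normal_pair z w t -> normal_pair z (conjc w) (- t).
Proof.
move=> [a [b [c [d [D0 mz mw]]]]]; exists a, b, c, d; split=> //.
exact: moves_conj.
Qed.

Lemma normal_pair_conjl z w t : normal_pair z w t -> normal_pair (conjc z) w (- t).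
Proof.
move=> [a [b [c [d [D0 mz mw]]]]]; exists (- a), b, (- c), d; split.
- by rewrite (_ : _ - _ = - (a * d - b * c)) ?oppr_eq0//; ring.
- by have := moves_flip (moves_conj mz); rewrite opprK.
- exact: moves_flip.
Qed.

Lemma normal_pair_exists z w : Im z != 0 -> Im w != 0 ->
  exists2 t, 1 <= `|t| & normal_pair z w t.
Proof.
have half w' : 0 < Im w' -> forall z, Im z != 0 ->
    exists2 t, 1 <= `|t| & normal_pair z w' t.
  move=> w0 {}z; rewrite neq_lt => /orP[] z0; last first.
    have [t t1 h] := upper_normal_pair z0 w0.
    by exists t => //; rewrite (le_trans t1)// ler_norm.
  have z0' : 0 < Im (conjc z) by rewrite conjcE oppr_gt0.
  have [t t1 h] := upper_normal_pair z0' w0.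
  exists (- t); first by rewrite normrN (le_trans t1)// ler_norm.
  by have := normal_pair_conjl h; rewrite conjcK.
move=> z0; rewrite neq_lt => /orP[] w0; last exact: half.
have w0' : 0 < Im (conjc w) by rewrite conjcE oppr_gt0.
have [t t1 h] := half _ w0' z z0.
by exists (- t); rewrite ?normrN//; have := normal_pair_conjr h; rewrite conjcK.
Qed.

Definition nrm2 (z : C) : R := Re z ^+ 2 + Im z ^+ 2.

(** For distances in the upper half-plane this is the classical
    |z - w|^2 / (Im z Im w) = 2 (cosh d - 1), with t = exp d. *)
Lemma normal_pair_invariant z w t : t != 0 -> normal_pair z w t ->
  nrm2 (z - w) * t = (t - 1) ^+ 2 * (Im z * Im w).
Proof.
move=> t0 [a [b [c [d [D0 mz mw]]]]].
have pz := moves_denom mz D0 (oner_neq0 R); have pw := moves_denom mw D0 t0.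
have iz := moves_Im mz; have rz := moves_Re mz.
have iw := moves_Im mw; have rw := moves_Re mw.
have {}iz : Im z = (a * d - b * c) / (d ^+ 2 + (c * 1) ^+ 2).
  by rewrite -[_ - _]mulr1 -iz mulfK// lt0r_neq0.
have {}rz : Re z = (b * d + a * 1 * (c * 1)) / (d ^+ 2 + (c * 1) ^+ 2).
  by rewrite -rz mulfK// lt0r_neq0.
have {}iw : Im w = (a * d - b * c) * t / (d ^+ 2 + (c * t) ^+ 2).
  by rewrite -iw mulfK// lt0r_neq0.
have {}rw : Re w = (b * d + a * t * (c * t)) / (d ^+ 2 + (c * t) ^+ 2).
  by rewrite -rw mulfK// lt0r_neq0.
have -> : nrm2 (z - w) = (Re z - Re w) ^+ 2 + (Im z - Im w) ^+ 2.
  by case: (z) (w) => [? ?] [? ?].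
rewrite rz rw iz iw; field.
by rewrite mulr1 in pz; rewrite !lt0r_neq0.
Qed.
End NormalForm.

(** * The hyperbolic distance of a pair in normal form *)

Section HyperbolicDistance.
Variable R : realType.
Local Notation C := (R[i]).
Local Notation Re := (@complex.Re R).
Local Notation Im := (@complex.Im R).
Implicit Types (a b c d s t : R) (z w : C) (f g x y : R -> R).

Lemma is_derive_Rmul f g df dg t : is_derive t 1 f df -> is_derive t 1 g dg ->
  is_derive t 1 (fun r => f r * g r) (df * g t + f t * dg).
Proof.
move=> hf hg; apply: (is_derive_ext (is_deriveM hf hg)) => //.
by rewrite /GRing.scale /=; ring.
Qed.

Lemma is_derive_Rscale k f df t : is_derive t 1 f df ->
  is_derive t 1 (fun r => k * f r) (k * df).
Proof. exact: is_deriveZ. Qed.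

Lemma is_derive_Radd f g df dg t : is_derive t 1 f df -> is_derive t 1 g dg ->
  is_derive t 1 (fun r => f r + g r) (df + dg).
Proof. exact: is_deriveD. Qed.

Lemma C1_cont f : C1 f -> continuous f.
Proof. by move=> [df _] t; apply/differentiable_continuous/derivable1_diffP. Qed.

Lemma C1_derive f t : C1 f -> is_derive t 1 f (f^`()%classic t).
Proof. by move=> [df _]; rewrite derive1E; apply: derivableP. Qed.

Lemma derive1_is f d t : is_derive t 1 f d -> f^`()%classic t = d.
Proof. by move=> [_ <-]; rewrite derive1E. Qed.

Lemma C1_of f g : (forall t, is_derive t 1 f (g t)) -> continuous g -> C1 f.
Proof.
move=> df cg; split; first by move=> t; case: (df t).
by rewrite (_ : _^`()%classic = g)//; apply/funext => t; exact: derive1_is.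
Qed.

Lemma C1_cst k : C1 (fun _ : R => k).
Proof.
apply: (@C1_of (cst k) (cst 0) (fun t => is_derive_cst k t 1)) => t.
exact: cst_continuous.
Qed.

Lemma C1D f g : C1 f -> C1 g -> C1 (fun t => f t + g t).
Proof.
move=> cf cg.
apply: (C1_of (fun t => is_deriveD (C1_derive t cf) (C1_derive t cg))) => t.
by apply: cvgD; [exact: cf.2|exact: cg.2].
Qed.

Lemma C1M f g : C1 f -> C1 g -> C1 (fun t => f t * g t).
Proof.
move=> cf cg.
apply: (C1_of (fun t => is_deriveM (C1_derive t cf) (C1_derive t cg))) => t.
have [_ cf'] := cf; have [_ cg'] := cg.
have {}cf := C1_cont cf; have {}cg := C1_cont cg.
exact: (continuousD (continuousM (cf t) (cg' t)) (continuousM (cg t) (cf' t))).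
Qed.

Lemma is_deriveVR f df t : f t != 0 -> is_derive t 1 f df ->
  is_derive t 1 (fun s => (f s)^-1) (- (f t) ^- 2 * df).
Proof.
move=> ft0 [dft <-]; apply: DeriveDef; first exact: derivableV.
by rewrite deriveV.
Qed.

Lemma C1V f : C1 f -> (forall t, f t != 0) -> C1 (fun t => (f t)^-1).
Proof.
move=> cf f0.
apply: (C1_of (fun t => is_deriveVR (f0 t) (C1_derive t cf))) => t.
apply: cvgM; last exact: cf.2.
apply: cvgN; apply: cvgV; first by rewrite expf_neq0.
by rewrite exprS expr1; apply: cvgM; exact: C1_cont.
Qed.

Lemma is_derive_expRM k t :
  is_derive t 1 (fun s => expR (k * s)) (k * expR (k * t)).
Proof.
have d : is_derive t 1 (fun s : R => k * s) k.
  apply: (is_derive_ext (is_deriveZ k (is_derive_id t 1))) => //.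
  by rewrite /GRing.scale /= mulr1.
apply: (is_derive_ext (is_derive1_comp (is_derive_expR (k * t)) d)) => //.
exact: mulrC.
Qed.

Lemma C1_expRM k : C1 (fun t => expR (k * t)).
Proof.
apply: (C1_of (is_derive_expRM k)) => t.
apply: cvgM; first exact: cvg_cst.
apply: continuous_comp; last exact: continuous_expR.
by apply: cvgM; [exact: cvg_cst|exact: cvg_id].
Qed.

Lemma within_cont f : (forall t, 0 <= t <= 1 -> {for t, continuous f}) ->
  {within `[(0 : R), 1], continuous f}.
Proof.
move=> cf; apply: continuous_in_subspaceT => t.
by rewrite inE /= in_itv /= => /cf.
Qed.

Lemma unit_itv_int f : (forall t, 0 <= t <= 1 -> {for t, continuous f}) ->
  (@lebesgue_measure R).-integrable `[0, 1] (EFin \o f).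
Proof.
move=> cf; apply: continuous_compact_integrable; first exact: segment_compact.
exact: within_cont.
Qed.

Lemma FTC_unit F f : (forall t, 0 <= t <= 1 -> is_derive t 1 F (f t)) ->
  (forall t, 0 <= t <= 1 -> {for t, continuous f}) ->
  \int[lebesgue_measure]_(t in `[0, 1]) f t = F 1 - F 0.
Proof.
move=> dF cf; rewrite /Rintegral (@continuous_FTC2 _ f F)//.
- exact: within_cont.
- have cF t : 0 <= t <= 1 -> {for t, continuous F}.
    by move=> /dF[dFt _]; apply/differentiable_continuous/derivable1_diffP.
  split.
  + move=> t; rewrite in_itv/= => /andP[t0 t1].
    by case: (dF t); rewrite ?(ltW t0) ?(ltW t1).
  + by apply: cvg_at_right_filter; apply: cF; rewrite lexx ler01.
  + by apply: cvg_at_left_filter; apply: cF; rewrite lexx ler01.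
- move=> t; rewrite in_itv/= => /andP[t0 t1].
  by apply: derive1_is; apply: dF; rewrite ?(ltW t0) ?(ltW t1).
Qed.

Definition speed x y t : R :=
  Num.sqrt (x^`()%classic t ^+ 2 + y^`()%classic t ^+ 2) / `|y t|.

Lemma cont_sqr f t : {for t, continuous f} -> {for t, continuous (fun r => f r ^+ 2)}.
Proof.
move=> cf; apply: (@continuous_comp _ _ _ f (fun u : R => u ^+ 2) t cf).
exact: exprn_continuous.
Qed.

Lemma speed_cont x y t : C1 x -> C1 y -> y t != 0 -> {for t, continuous (speed x y)}.
Proof.
move=> cx cy y0.
have cs : {for t, continuous
    ((fun r => x^`()%classic r ^+ 2) + (fun r => y^`()%classic r ^+ 2))}.
  by apply: continuousD; apply: cont_sqr; [case: cx => _|case: cy => _]; apply.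
have cn : {for t, continuous (fun r => Num.sqrt
    (((fun r => x^`()%classic r ^+ 2) + (fun r => y^`()%classic r ^+ 2)) r))}.
  by apply: (continuous_comp cs); exact: sqrt_continuous.
have cy' : {for t, continuous (fun r => `|y r|)}.
  by apply: (@continuous_comp _ _ _ y (@Num.norm R R)); [exact: C1_cont|exact: norm_continuous].
have ci : {for t, continuous (fun r => (`|y r|)^-1)}.
  by apply: cvgV => //; rewrite normr_eq0.
exact: (continuousM cn ci).
Qed.

(** The quotient y / N is, up to a constant factor, the imaginary part of the
    image of x + i y under a real Moebius map.  The gradient of its logarithm has
    hyperbolic norm one, so its variation is at most the length. *)
Lemma poincare_length_lower a c x y s0 s1 : (a != 0) || (c != 0) ->
  C1 x -> C1 y -> (forall t, 0 <= t <= 1 -> 0 < y t) ->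
  let N t := (a - c * x t) ^+ 2 + c ^+ 2 * y t ^+ 2 in
  y 0 / N 0 = s0 -> y 1 / N 1 = s1 ->
  ln s1 - ln s0 <= poincare_length x y.
Proof.
move=> ac cx cy y0 N e0 e1.
have N0 t : 0 <= t <= 1 -> 0 < N t.
  move=> /y0 yt; have [c0|c0] := eqVneq c 0.
    move: ac; rewrite c0 eqxx orbF => a0.
    by rewrite /N c0 !mul0r subr0 expr0n mul0r addr0 exprn_even_gt0.
  rewrite /N; apply: ltr_wpDl; first exact: sqr_ge0.
  by rewrite mulr_gt0//; [rewrite exprn_even_gt0|rewrite exprn_gt0].
pose x' : R -> R := x^`()%classic; pose y' : R -> R := y^`()%classic.
pose N' t := 2 * (a - c * x t) * (- c * x' t) + c ^+ 2 * (2 * y t * y' t).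
pose F t := ln (y t) - ln (N t).
pose f t := (y t)^-1 * y' t - (N t)^-1 * N' t.
have dN (t : R) : is_derive t 1 N (N' t).
  have dx : is_derive t 1 x (x' t) by exact: C1_derive.
  have dy : is_derive t 1 y (y' t) by exact: C1_derive.
  have dl := is_derive_Radd (is_derive_cst a t 1) (is_derive_Rscale (- c) dx).
  apply: (is_derive_ext (is_derive_Radd (is_derive_Rmul dl dl)
    (is_derive_Rscale (c ^+ 2) (is_derive_Rmul dy dy)))) => [r|].
    by rewrite /N /= mulNr !expr2.
  by rewrite /N' /=; ring.
have dF t : 0 <= t <= 1 -> is_derive t 1 F (f t).
  move=> t01; have dy := C1_derive t cy.
  exact: (is_deriveB (is_derive1_comp (is_derive1_ln (y0 _ t01)) dy)
    (is_derive1_comp (is_derive1_ln (N0 _ t01)) (dN t))).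
have cont_x := C1_cont cx; have cont_y := C1_cont cy.
have cont_N : continuous N.
  by move=> t; apply/differentiable_continuous/derivable1_diffP; case: (dN t).
have cx' : continuous x' by case: cx.
have cy' : continuous y' by case: cy.
have cont_N' : continuous N'.
  move=> t; apply: cvgD; apply: cvgM.
  - apply: cvgM; first exact: cvg_cst.
    by apply: cvgB; [exact: cvg_cst|apply: cvgM; [exact: cvg_cst|exact: cont_x]].
  - by apply: cvgM; [exact: cvg_cst|exact: cx'].
  - exact: cvg_cst.
  - apply: cvgM; last exact: cy'.
    by apply: cvgM; [exact: cvg_cst|exact: cont_y].
have cf t : 0 <= t <= 1 -> {for t, continuous f}.
  move=> t01; apply: cvgB; apply: cvgM.
  - by apply: cvgV; [rewrite lt0r_neq0// y0|exact: cont_y].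
  - exact: cy'.
  - by apply: cvgV; [rewrite lt0r_neq0// N0|exact: cont_N].
  - exact: cont_N'.
have int_f := FTC_unit dF cf.
have i01 : ((0 : R) <= 0) && ((0 : R) <= 1) by rewrite lexx ler01.
have i11 : ((0 : R) <= 1) && ((1 : R) <= 1) by rewrite lexx ler01.
have -> : ln s1 - ln s0 = F 1 - F 0.
  by rewrite -e0 -e1 !ln_div ?posrE ?y0 ?N0.
rewrite -int_f; apply: le_Rintegral => //; first exact: unit_itv_int.
  apply: unit_itv_int => t t01; apply: speed_cont => //.
  by rewrite lt0r_neq0// y0.
move=> t /=; rewrite in_itv /= => t01.
have yt := y0 _ t01; have Nt := N0 _ t01.
rewrite (gtr0_norm yt) ler_pdivlMr//.
have -> : f t * y t = (y' t * ((a - c * x t) ^+ 2 - c ^+ 2 * y t ^+ 2) +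
    x' t * (2 * (a - c * x t) * c * y t)) / N t.
  rewrite /f /N' /N; field.
  by rewrite exprMn !lt0r_neq0.
set p := (_ - _); set q := (2 * _ * _ * _).
(* The norm of the gradient; the estimate is then Cauchy-Schwarz in the plane. *)
have pq : p ^+ 2 + q ^+ 2 = N t ^+ 2 by rewrite /p /q /N; ring.
rewrite ler_pdivrMr//; apply: le_trans (ler_norm _) _.
rewrite -sqrtr_sqr -(gtr0_norm Nt) -(sqrtr_sqr (N t)) -sqrtrM ?addr_ge0 ?sqr_ge0//.
apply: ler_wsqrtr; rewrite -pq -subr_ge0.
rewrite (_ : _ - _ = (y' t * q - x' t * p) ^+ 2) ?sqr_ge0//.
by rewrite -/(x' t) -/(y' t); ring.
Qed.

(** The image of the path r |-> i t^r, which has constant hyperbolic speed ln t. *)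
Lemma geodesic_exists a b c d t z w : 1 <= t -> 0 < a * d - b * c ->
  moves a b c d 1 z -> moves a b c d t w -> exists x y,
  [/\ C1 x /\ C1 y, Complex (x 0) (y 0) = z /\ Complex (x 1) (y 1) = w,
      forall r, 0 < y r & poincare_length x y = ln t].
Proof.
move=> t1 D0 mz mw.
have t0 : 0 < t by exact: lt_le_trans ltr01 t1.
have Dn0 := lt0r_neq0 D0.
pose l := ln t; pose E r := expR (l * r).
pose W r := d ^+ 2 + (c * E r) ^+ 2.
have E0 r : 0 < E r by exact: expR_gt0.
have W0 r : 0 < W r.
  rewrite lt_def addr_ge0 ?sqr_ge0// andbT.
  rewrite paddr_eq0 ?sqr_ge0// !sqrf_eq0 mulf_eq0 (negbTE (lt0r_neq0 (E0 r))) orbF.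
  by apply: contra Dn0 => /andP[/eqP-> /eqP->]; rewrite !mulr0 subrr.
pose x r := (b * d + a * E r * (c * E r)) * (W r)^-1.
pose y r := (a * d - b * c) * E r * (W r)^-1.
have dE (r : R) : is_derive r 1 E (l * E r) by exact: is_derive_expRM.
have CE : C1 E by exact: C1_expRM.
have CcE k : C1 (fun r => k * E r) by apply: C1M => //; exact: C1_cst.
have CW : C1 W.
  have -> : W = (fun r => d ^+ 2 + (c * E r) * (c * E r)).
    by apply/funext => r; rewrite /W [(_ * _) ^+ 2]expr2.
  by apply: C1D; [exact: C1_cst|exact: C1M].
have CV : C1 (fun r => (W r)^-1) by apply: C1V => // r; rewrite lt0r_neq0.
have Cx : C1 x by apply: C1M => //; apply: C1D; [exact: C1_cst|exact: C1M].
have Cy : C1 y by exact: C1M.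
have dW (r : R) : is_derive r 1 W (2 * l * (c * E r) ^+ 2).
  have dcE := is_derive_Rscale c (dE r).
  apply: (is_derive_ext (is_derive_Radd (is_derive_cst (d ^+ 2) r 1)
    (is_derive_Rmul dcE dcE))) => [s|]; first by rewrite /W [(_ * _) ^+ 2]expr2.
  by ring.
have dV r := is_deriveVR (lt0r_neq0 (W0 r)) (dW r).
have x'E r : x^`()%classic r =
    (a * d - b * c) * l * (2 * c * d * E r ^+ 2) / W r ^+ 2.
  have dac := is_derive_Rmul (is_derive_Rscale a (dE r)) (is_derive_Rscale c (dE r)).
  have := is_derive_Rmul (is_derive_Radd (is_derive_cst (b * d) r 1) dac) (dV r).
  move/derive1_is => ->; rewrite /cst.
  have := lt0r_neq0 (W0 r); rewrite /W => Wr.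
  by field.
have y'E r : y^`()%classic r =
    (a * d - b * c) * l * (E r * (d ^+ 2 - (c * E r) ^+ 2)) / W r ^+ 2.
  have := is_derive_Rmul (is_derive_Rscale (a * d - b * c) (dE r)) (dV r).
  move/derive1_is => ->; rewrite /cst.
  have := lt0r_neq0 (W0 r); rewrite /W => Wr.
  by field.
have y0 r : 0 < y r by rewrite /y divr_gt0// mulr_gt0.
exists x, y; split=> //.
- have e0 : E 0 = 1 by rewrite /E mulr0 expR0.
  have e1 : E 1 = t by rewrite /E mulr1 lnK.
  have w0 := lt0r_neq0 (W0 0); have w1 := lt0r_neq0 (W0 1).
  rewrite /W e0 in w0; rewrite /W e1 in w1.
  rewrite /x /y /W e0 e1 -(moves_Im mz) -(moves_Re mz) -(moves_Im mw) -(moves_Re mw).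
  rewrite !mulfK//.
  by case: (z) (w) => [? ?] [].
have l0 : 0 <= l by exact: ln_ge0.
transitivity (\int[lebesgue_measure]_(r in `[0, 1]) l).
  apply: eq_Rintegral => r _; rewrite (gtr0_norm (y0 r)) x'E y'E.
  have -> : ((a * d - b * c) * l * (2 * c * d * E r ^+ 2) / W r ^+ 2) ^+ 2 +
      ((a * d - b * c) * l * (E r * (d ^+ 2 - (c * E r) ^+ 2)) / W r ^+ 2) ^+ 2 =
      (l * y r) ^+ 2.
    have := lt0r_neq0 (W0 r); rewrite /y /W => Wr.
    by field.
  rewrite sqrtr_sqr ger0_norm; last by rewrite mulr_ge0// ltW.
  by rewrite mulfK// lt0r_neq0.
have dl (r : R) : 0 <= r <= 1 -> is_derive r 1 (fun u => l * u) ((cst l) r).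
  move=> _; apply: is_derive_ext (is_derive_Rscale l (is_derive_id r 1)) _ _ => //.
  exact: mulr1.
have cl (r : R) : 0 <= r <= 1 -> {for r, continuous (cst l)}.
  by move=> _; exact: cst_continuous.
by transitivity (l * 1 - l * 0); [exact: (FTC_unit dl cl)|rewrite mulr1 mulr0 subr0].
Qed.

Lemma inf_eq_min (S : set R) m : S m -> lbound S m -> inf S = m.
Proof.
move=> Sm lbm; apply/eqP; rewrite eq_le; apply/andP; split.
  by apply: ge_inf => //; exists m.
by apply: lb_le_inf => //; exists m.
Qed.

(** The lower bound applied to the inverse of the matrix and the upper bound
    given by the geodesic coincide. *)
Lemma hyp_dist_moves_pos a b c d t z w : 1 <= t -> 0 < a * d - b * c ->
  moves a b c d 1 z -> moves a b c d t w -> hyp_dist z w = ln t.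
Proof.
move=> t1 D0 mz mw; have t0 : 0 < t by exact: lt_le_trans ltr01 t1.
have tn0 := lt0r_neq0 t0; have Dn0 := lt0r_neq0 D0.
have z0 : 0 < Im z.
  have p := moves_denom mz Dn0 (oner_neq0 R).
  by rewrite -(pmulr_lgt0 _ p) (moves_Im mz) mulr1.
apply: inf_eq_min.
  have [x [y [C [e0 e1] y0 len]]] := geodesic_exists t1 D0 mz mw.
  exists x, y; split; rewrite ?len//.
  by move=> r _; left; split=> /=.
move=> l [x [y [[Cx Cy] [e0 e1] half ->]]].
have y0 r : 0 <= r <= 1 -> 0 < y r.
  by move=> /half[[]//|[zn]]; rewrite ltNge (ltW z0) in zn.
have i01 : ((0 : R) <= 0) && ((0 : R) <= 1) by rewrite lexx ler01.
have i11 : ((0 : R) <= 1) && ((1 : R) <= 1) by rewrite lexx ler01.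
have := moves_pullback (oner_neq0 R) mz; rewrite mul1r -e0 /= => p0.
have := moves_pullback tn0 mw; rewrite -e1 /= => p1.
have ac : (a != 0) || (c != 0).
  apply: contraNT Dn0; rewrite negb_or !negbK => /andP[/eqP-> /eqP->].
  by rewrite mul0r mulr0 subrr.
have y00 := y0 _ i01; have y10 := y0 _ i11.
have -> : ln t = ln (t / (a * d - b * c)) - ln (a * d - b * c)^-1.
  by rewrite ln_div ?posrE// lnV ?posrE//; ring.
apply: (@poincare_length_lower a c) => //.
- rewrite p0; field.
  by rewrite !lt0r_neq0.
- have -> : (a - c * x 1) ^+ 2 + c ^+ 2 * y 1 ^+ 2 = (a * d - b * c) * y 1 / t.
    by rewrite -p1 [t * _]mulrC mulfK.
  field.
  by rewrite !lt0r_neq0.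
Qed.

Lemma hyp_dist_conj z w : hyp_dist (conjc z) (conjc w) = hyp_dist z w.
Proof.
have sub z' w' l : (exists x y, [/\ C1 x /\ C1 y,
        Complex (x 0) (y 0) = z' /\ Complex (x 1) (y 1) = w',
        forall t, 0 <= t <= 1 -> same_half_plane z' (Complex (x t) (y t))
      & l = poincare_length x y]) -> exists x y, [/\ C1 x /\ C1 y,
        Complex (x 0) (y 0) = conjc z' /\ Complex (x 1) (y 1) = conjc w',
        forall t, 0 <= t <= 1 -> same_half_plane (conjc z') (Complex (x t) (y t))
      & l = poincare_length x y].
  move=> [x [y [[Cx Cy] [<- <-] half ->]]]; exists x, (fun t => - y t); split=> //.
  - split=> //; have -> : (fun t => - y t) = (fun t => (- 1) * y t).
      by apply/funext => t; rewrite mulN1r.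
    by apply: C1M => //; exact: C1_cst.
  - move=> t /half[[/= h1 h2]|[/= h1 h2]]; [right|left]; split=> /=;
      by rewrite ?oppr_lt0 ?oppr_gt0.
  - apply: eq_Rintegral => t _; rewrite normrN.
    rewrite [X in _ = Num.sqrt (_ + X ^+ 2) / _](_ : _ = - y^`()%classic t) ?sqrrN//.
    by apply: derive1_is; exact: is_deriveN (C1_derive t Cy).
congr inf; apply/seteqP; split=> l /=; last exact: sub.
by move/sub; rewrite !conjcK.
Qed.

(** A matrix of negative determinant moves i to the lower half-plane, which
    complex conjugation exchanges with the upper one. *)
Lemma hyp_dist_normal_pair z w t : 1 <= t -> normal_pair z w t -> hyp_dist z w = ln t.
Proof.
move=> t1 [a [b [c [d [D0 mz mw]]]]]; move: D0; rewrite neq_lt => /orP[] D0.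
  rewrite -hyp_dist_conj; apply: (@hyp_dist_moves_pos (- a) b (- c) d) => //.
  - by rewrite (_ : _ - _ = - (a * d - b * c)) ?oppr_gt0//; ring.
  - by have := moves_flip (moves_conj mz); rewrite opprK.
  - by have := moves_flip (moves_conj mw); rewrite opprK.
exact: (@hyp_dist_moves_pos a b c d).
Qed.
End HyperbolicDistance.

(** * The two families in terms of the normal form *)

Section Families.
Variable R : realType.
Local Notation C := (R[i]).
Local Notation Re := (@complex.Re R).
Local Notation Im := (@complex.Im R).
Implicit Types (d t : R) (z w : C) (s : S2CP1 R).

Lemma normal_pair_nonreal z w t : t != 0 -> normal_pair z w t ->
  (Im z != 0) * (Im w != 0).
Proof.
move=> t0 [a [b [c [d [D0 mz mw]]]]]; split; apply/eqP => e.
- move/eqP: D0; apply; have := moves_Im mz.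
  by rewrite e mul0r mulr1.
- have := mulf_neq0 D0 t0; rewrite -(moves_Im mw) e mul0r.
  by rewrite eqxx.
Qed.

Lemma normal_pair_sign z w t : t != 0 -> normal_pair z w t -> (0 < Im z * Im w) = (0 < t).
Proof.
move=> t0 [a [b [c [d [D0 mz mw]]]]].
have pz := moves_denom mz D0 (oner_neq0 R); have pw := moves_denom mw D0 t0.
rewrite -(pmulr_lgt0 _ (mulr_gt0 pz pw)) mulrACA (moves_Im mz) (moves_Im mw).
rewrite mulr1 mulrA -expr2 pmulr_rgt0//.
by rewrite exprn_even_gt0.
Qed.

Lemma same_half_planeE z w : same_half_plane z w <-> 0 < Im z * Im w.
Proof.
rewrite /same_half_plane; split=> [|]; first by move=> [] []; nra.
have [z0|z0|->] := ltrgtP (Im z) 0; last by rewrite mul0r ltxx.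
- by rewrite nmulr_rgt0 // => w0; right.
- by rewrite pmulr_rgt0 // => w0; left.
Qed.

Lemma opposite_half_planesE z w : opposite_half_planes z w <-> Im z * Im w < 0.
Proof.
rewrite /opposite_half_planes; split=> [|]; first by move=> [] []; nra.
have [z0|z0|->] := ltrgtP (Im z) 0; last by rewrite mul0r ltxx.
- by rewrite nmulr_rlt0 // => w0; right.
- by rewrite pmulr_rlt0 // => w0; left.
Qed.

Definition orbit_pairs t : set (S2CP1 R) :=
  [set s | exists z w, s = upair (Some z) (Some w) /\ normal_pair z w t].

Lemma norm_ge1_neq0 t : 1 <= `|t| -> t != 0.
Proof. by move=> t1; rewrite -normr_gt0 (lt_le_trans ltr01). Qed.

Lemma normal_pair_exists_pos z w : 0 < Im z * Im w ->
  exists2 t, 1 <= t & normal_pair z w t.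
Proof.
move=> zw; have : Im z * Im w != 0 by rewrite lt0r_neq0.
rewrite mulf_eq0 negb_or => /andP[z0 w0].
have [t t1 h] := normal_pair_exists z0 w0; exists t => //.
by move: zw; rewrite (normal_pair_sign (norm_ge1_neq0 t1) h) => tp; rewrite gtr0_norm in t1.
Qed.

Lemma normal_pair_exists_neg z w : Im z * Im w < 0 ->
  exists2 t, 1 <= t & normal_pair z w (- t) /\ normal_pair z (conjc w) t.
Proof.
move=> zw; have [|t t1 h] := @normal_pair_exists_pos z (conjc w).
  by rewrite conjcE mulrN oppr_gt0.
by exists t => //; split=> //; have := normal_pair_conjr h; rewrite conjcK.
Qed.

Lemma familyIE d : 0 <= d -> familyI d = orbit_pairs (expR d).
Proof.
move=> d0; have t1 : 1 <= expR d by rewrite -expR0 ler_expR.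
have t0 : expR d != 0 by rewrite lt0r_neq0 ?expR_gt0.
apply/seteqP; split=> s [z [w]]; last first.
  move=> [-> h]; exists z, w; split=> //.
    by apply/same_half_planeE; rewrite (normal_pair_sign t0 h) expR_gt0.
  by rewrite (hyp_dist_normal_pair t1 h) expRK.
move=> [-> /same_half_planeE half dd]; exists z, w; split=> //.
have [t tge1 h] := normal_pair_exists_pos half.
by rewrite -dd (hyp_dist_normal_pair tge1 h) lnK// posrE (lt_le_trans ltr01).
Qed.

Lemma familyIIE d : 0 < d -> familyII d = orbit_pairs (- expR d).
Proof.
move=> d0; have t1 : 1 < expR d by rewrite -expR0 ltr_expR.
have tp := expR_gt0 d.
have t0 : - expR d != 0 by rewrite oppr_eq0 lt0r_neq0.
apply/seteqP; split=> s [z [w]]; last first.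
  move=> [-> h]; have [z0 w0] := normal_pair_nonreal t0 h.
  have h' := normal_pair_conjr h; rewrite opprK in h'.
  exists z, w; split=> //.
  - apply/opposite_half_planesE; rewrite lt_neqAle mulf_neq0//= leNgt.
    by rewrite (normal_pair_sign t0 h) oppr_gt0 -leNgt ltW.
  - move=> zw; have := normal_pair_invariant (lt0r_neq0 tp) h'.
    rewrite -zw subrr /nrm2 /= expr0n addr0 mul0r => /esym/eqP.
    by rewrite !mulf_eq0 (negbTE z0) !orbF orbb subr_eq0 gt_eqF.
  - by rewrite (hyp_dist_normal_pair (ltW t1) h') expRK.
move=> [-> /opposite_half_planesE half _ dd]; exists z, w; split=> //.
have [t tge1 [h h']] := normal_pair_exists_neg half.
by rewrite -dd (hyp_dist_normal_pair tge1 h') lnK// posrE (lt_le_trans ltr01).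
Qed.

(** The function (t - 1)^2 / t takes equal values at t and t' only if t = t' or
    t t' = 1. *)
Lemma normal_pair_param_inj t t' : 1 <= `|t| -> 1 <= `|t'| ->
  (t - 1) ^+ 2 * t' = (t' - 1) ^+ 2 * t -> t = t'.
Proof.
move=> t1 t1' e.
have : (t - t') * (t * t' - 1) = 0.
  by transitivity ((t - 1) ^+ 2 * t' - (t' - 1) ^+ 2 * t); [ring|rewrite e subrr].
move/eqP; rewrite mulf_eq0 !subr_eq0 => /orP[/eqP//|/eqP tt'].
move: t1 t1'; case: (ger0P t) => t0; case: (ger0P t') => t0' t1 t1'; nra.
Qed.

Lemma nrm2B z w : nrm2 (z - w) = nrm2 (w - z).
Proof. by rewrite /nrm2 -opprB; case: (w - z) => ? ? /=; rewrite !sqrrN. Qed.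

Lemma normal_pair_unique z w z' w' t t' : 1 <= `|t| -> 1 <= `|t'| ->
  normal_pair z w t -> normal_pair z' w' t' ->
  upair (Some z) (Some w) = upair (Some z') (Some w') -> t = t'.
Proof.
move=> t1 t1' h h' e.
have t0 := norm_ge1_neq0 t1; have t0' := norm_ge1_neq0 t1'.
have [z0 w0] := normal_pair_nonreal t0 h.
have i1 := normal_pair_invariant t0 h; have i2 := normal_pair_invariant t0' h'.
have {i2} i2 : nrm2 (z - w) * t' = (t' - 1) ^+ 2 * (Im z * Im w).
  move: i2; case: ((upairP _ _ _ _).1 e) => [] [[<-] [<-]] //.
  by rewrite nrm2B [Im w * _]mulrC.
apply: normal_pair_param_inj => //; apply: (mulIf (mulf_neq0 z0 w0)).
by rewrite mulrAC -i1 [RHS]mulrAC -i2; ring.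
Qed.

Lemma normal_pair_base t : normal_pair (Complex 0 1) (Complex 0 t) t.
Proof.
exists 1, 0, 0, 1; split; first by rewrite mulr1 mulr0 subr0 oner_neq0.
- by split=> /=; ring.
- by split=> /=; ring.
Qed.

Lemma orbit_pairs_inj t t' : 1 <= `|t| -> 1 <= `|t'| ->
  orbit_pairs t = orbit_pairs t' -> t = t'.
Proof.
move=> t1 t1' e.
have : orbit_pairs t (upair (Some (Complex 0 1)) (Some (Complex 0 t))).
  by exists (Complex 0 1), (Complex 0 t); split=> //; exact: normal_pair_base.
rewrite e => -[z [w [e' h]]].
exact: (normal_pair_unique t1 t1' (normal_pair_base t) h e').
Qed.

(** Membership is decided by the invariant alone, so the order of the two points
    and the choice of the matrix do not matter. *)
Lemma orbit_pairsP t z w : 1 <= `|t| ->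
  orbit_pairs t (upair (Some z) (Some w)) <->
  [/\ Im z != 0, Im w != 0 & nrm2 (z - w) * t = (t - 1) ^+ 2 * (Im z * Im w)].
Proof.
move=> t1; have t0 := norm_ge1_neq0 t1; split.
  move=> [z' [w' [e h]]]; have [z0 w0] := normal_pair_nonreal t0 h.
  have := normal_pair_invariant t0 h.
  case: ((upairP _ _ _ _).1 e) => [] [[->] [->]] //.
  by rewrite nrm2B [Im z' * _]mulrC.
move=> [z0 w0 e]; exists z, w; split=> //.
have [t' t1' h] := normal_pair_exists z0 w0.
rewrite (_ : t = t')//; apply: normal_pair_param_inj => //.
apply: (mulIf (mulf_neq0 z0 w0)).
by rewrite mulrAC -e [RHS]mulrAC -(normal_pair_invariant (norm_ge1_neq0 t1') h); ring.
Qed.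

Lemma familyI0 : familyI 0 = @double_nonreal R.
Proof.
have t1 : 1 <= `|1 : R| by rewrite normr1.
rewrite familyIE// expR0; apply/seteqP; split=> s.
  move=> hs; have [z [w [e _]]] := hs; move: hs; rewrite e => /orbit_pairsP.
  move=> /(_ t1)[z0 w0]; rewrite subrr expr0n mul0r mulr1 => /eqP.
  rewrite paddr_eq0 ?sqr_ge0// !sqrf_eq0 => /andP[/eqP e1 /eqP e2].
  exists z; first exact/eqP.
  have -> // : w = z; apply/esym/eqP; rewrite -subr_eq0 eq_complex.
  by rewrite e1 e2 !eqxx.
move=> [z /eqP z0 ->]; apply/orbit_pairsP => //; split=> //.
by rewrite !subrr /nrm2 /= expr0n addr0 !mul0r.
Qed.

End Families.

(** * The quadratic and the hermitian invariant *)

Section Forms.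
Variable R : realType.
Local Notation C := (R[i]).
Local Notation Re := (@complex.Re R).
Local Notation Im := (@complex.Im R).
Local Notation mxRe := (map_mx Re).
Local Notation mxIm := (map_mx Im).
Implicit Types (L M : 'M[C]_2) (k z w : C).

(** The trace of L times its conjugate, when L is traceless. *)
Definition hform L : R :=
  2 * (Re (L 0 0) ^+ 2 + Im (L 0 0) ^+ 2 +
       Re (L 0 1) * Re (L 1 0) + Im (L 0 1) * Im (L 1 0)).

(** Half of the trace of the square of L, when L is traceless. *)
Definition qform L : C := L 0 0 ^+ 2 + L 0 1 * L 1 0.

Lemma nrm2M z w : nrm2 (z * w) = nrm2 z * nrm2 w.
Proof. by case: z w => [x y] [u v]; rewrite /nrm2 /=; ring. Qed.

Lemma nrm2_eq0 z : (nrm2 z == 0) = (z == 0).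
Proof.
by case: z => x y; rewrite /nrm2 paddr_eq0 ?sqr_ge0// !sqrf_eq0 eq_complex.
Qed.

Lemma nrm2_ge0 z : 0 <= nrm2 z.
Proof. by rewrite addr_ge0// sqr_ge0. Qed.

Lemma hformZ k L : hform (k *: L) = nrm2 k * hform L.
Proof.
rewrite /hform !mxE /nrm2; case: k => x y.
case: (L 0 0) => ? ?; case: (L 0 1) => ? ?; case: (L 1 0) => ? ? /=.
ring.
Qed.

Lemma qformZ k L : nrm2 (qform (k *: L)) = nrm2 k ^+ 2 * nrm2 (qform L).
Proof.
have -> : qform (k *: L) = k * k * qform L by rewrite /qform !mxE; ring.
by rewrite !nrm2M expr2.
Qed.

(** With [qform_det], this shows that maps preserving the determinant of real
    traceless matrices preserve [hform] and the modulus of [qform]. *)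
Lemma hform_det L : \tr L = 0 -> hform L = - 2 * (\det (mxRe L) + \det (mxIm L)).
Proof.
move=> /mxtrace2_eq0 trL; rewrite /hform !det2E !mxE trL.
by case: (L 0 0) => ? ? /=; ring.
Qed.

Lemma qform_det L : \tr L = 0 -> nrm2 (qform L) =
  (\det (mxIm L) - \det (mxRe L)) ^+ 2 +
  (\det (mxRe L) + \det (mxIm L) - \det (mxRe L + mxIm L)) ^+ 2.
Proof.
move=> /mxtrace2_eq0 trL; rewrite /nrm2 /qform !det2E !mxE trL.
case: (L 0 0) => ? ?; case: (L 0 1) => ? ?; case: (L 1 0) => ? ? /=.
by rewrite ?expr2 /=; ring.
Qed.

Lemma invnC n : (n%:R^-1 : C) = Complex n%:R^-1 0.
Proof. by rewrite -[RHS]/(real_complex R _) fmorphV rmorph_nat. Qed.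

Lemma hform_pair z w : hform (pair_mx (Some z) (Some w)) =
  nrm2 (z - w) / 2 + 4 * (Im z * Im w).
Proof.
rewrite /hform /pair_mx !sl2mxE /nrm2.
have -> : (z + w) / 2 = Complex ((Re z + Re w) / 2) ((Im z + Im w) / 2).
  rewrite invnC; case: z w => [x y] [u v].
  by apply/eqP; rewrite eq_complex /=; apply/andP; split; apply/eqP; ring.
by case: z w => [x y] [u v] /=; field.
Qed.

Lemma qform_pair z w : nrm2 (qform (pair_mx (Some z) (Some w))) =
  (nrm2 (z - w) / 4) ^+ 2.
Proof.
have -> : qform (pair_mx (Some z) (Some w)) = (z - w) * (z - w) * (4^-1).
  by rewrite /qform !sl2mxE; field.
rewrite !nrm2M.
rewrite invnC /nrm2 /=.
by field.
Qed.

(** The value of the invariant h / (2 |q|) at the normal form of parameter t is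
    (t^2 + 6 t + 1) / (t - 1)^2; denominators are cleared to include t = 1. *)
Definition form_rel (t : R) L : Prop :=
  (t - 1) ^+ 2 * hform L = 2 * (t ^+ 2 + 6 * t + 1) * Num.sqrt (nrm2 (qform L)).

Lemma form_relZ t k L : k != 0 -> form_rel t (k *: L) <-> form_rel t L.
Proof.
move=> k0; have K0 : nrm2 k != 0 by rewrite nrm2_eq0.
rewrite /form_rel hformZ qformZ sqrtrM ?sqr_ge0// sqrtr_sqr ger0_norm ?nrm2_ge0//.
split=> [h|h]; last by rewrite mulrCA h; ring.
by apply: (mulfI K0); rewrite mulrCA h; ring.
Qed.

Lemma form_rel_pair t z w : form_rel t (pair_mx (Some z) (Some w)) <->
  nrm2 (z - w) * t = (t - 1) ^+ 2 * (Im z * Im w).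
Proof.
rewrite /form_rel hform_pair qform_pair sqrtr_sqr ger0_norm ?divr_ge0 ?nrm2_ge0//.
set N := nrm2 _; set P := Im z * Im w; split=> e; last by lra.
by apply: (@mulfI _ 4); [rewrite pnatr_eq0|lra].
Qed.

(** Up to sign and a factor, the difference is the Gram determinant of L and its
    conjugate for the Killing form. *)
Definition regular_mx L : bool := hform L ^+ 2 != 4 * nrm2 (qform L).

Lemma regular_mxZ k L : k != 0 -> regular_mx (k *: L) = regular_mx L.
Proof.
move=> k0; have K0 : nrm2 k ^+ 2 != 0 by rewrite expf_neq0// nrm2_eq0.
by rewrite /regular_mx hformZ qformZ exprMn [4 * _]mulrCA (inj_eq (mulfI K0)).
Qed.

Lemma regular_mx_pair (z w : CP1 R) : regular_mx (pair_mx z w) <->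
  exists x y, [/\ z = Some x, w = Some y, Im x != 0, Im y != 0 & x != conjc y].
Proof.
have inf x : regular_mx (pair_mx (Some x) None) = false.
  apply/negbTE; rewrite negbK /regular_mx /hform /qform /= !sl2mxE !mulr0 addr0.
  rewrite div1r invnC.
  by rewrite /nrm2 /=; apply/eqP; field.
have inf2 : regular_mx (pair_mx (@None C) None) = false.
  apply/negbTE; rewrite negbK /regular_mx /hform /qform /= !sl2mxE /nrm2 /=.
  by apply/eqP; rewrite !mulr0 !expr0n /= !addr0 ; ring.
case: z w => [x|] [y|]; last first.
- by rewrite inf2; split=> // -[? [? []]].
- by rewrite pair_mxC inf; split=> // -[? [? []]].
- by rewrite inf; split=> // -[? [? []]].
have key : regular_mx (pair_mx (Some x) (Some y)) =
    (Im x * Im y * nrm2 (x - conjc y) != 0).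
  rewrite /regular_mx hform_pair qform_pair -subr_eq0.
  rewrite (_ : _ - _ = 4 * (Im x * Im y * nrm2 (x - conjc y))).
    by rewrite mulf_eq0 pnatr_eq0.
  by case: x y => [? ?] [? ?]; rewrite /nrm2 /=; field.
rewrite key !mulf_eq0 nrm2_eq0 subr_eq0 !negb_or; split.
  by move=> /andP[/andP[x0 y0] xy]; exists x, y.
by move=> [_ [_ [[<-] [<-] -> -> ->]]].
Qed.

End Forms.

(** * Real, degenerate and regular points in terms of the roots *)

Lemma comm2_span (T : comPzRingType) (L M : 'M[T]_2) (x1 x2 y1 y2 : T) :
  comm2 (x1 *: L + x2 *: M) (y1 *: L + y2 *: M) =
  (x1 * y2 - x2 * y1) *: comm2 L M.
Proof. by apply: mx2P; rewrite [RHS]mxE !comm2E !mxE; ring. Qed.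

(** The three hypotheses are the coordinates of the equation
    [L, L'] = a L + b L' for matrices with lower left entry 1, diagonal entries u
    and u', and upper right entries - v and - v'; eliminating a and b leaves the
    resultant of the two root polynomials. *)
Lemma bracket_elimination (T : comPzRingType) (u u' v v' a b : T) :
  2 * (u' - u) = a + b -> v' - v = a * u + b * u' ->
  2 * (u' * v - u * v') = - (a * v + b * v') ->
  (v' - v) ^+ 2 + 4 * (u' - u) * (u' * v - u * v') = 0.
Proof.
move=> e1 e2 e3.
transitivity ((u' * v - u * v') * (2 * (u' - u)) + (v' - v) * (v' - v) +
  (u' - u) * (2 * (u' * v - u * v'))); first by ring.
by rewrite e1 e3 {2}e2; ring.
Qed.

Lemma resultant_midpoints (T : fieldType) (x y x' y' : T) : 2 != 0 :> T ->
  (x - x') * (x - y') * (y - x') * (y - y') =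
  (x' * y' - x * y) ^+ 2 + 4 * ((x' + y') / 2 - (x + y) / 2) *
  ((x' + y') / 2 * (x * y) - (x + y) / 2 * (x' * y')).
Proof. by move=> two; field. Qed.

Section Points.
Variable R : realType.
Local Notation C := (R[i]).
Local Notation Re := (@complex.Re R).
Local Notation Im := (@complex.Im R).
Local Notation Psl2C := (Psl2C R).
Implicit Types (L M : 'M[C]_2) (k : C) (z w : CP1 R) (p q : Psl2C).

Lemma vline_scale k L : k != 0 -> <[k *: L]>%VS = <[L]>%VS.
Proof.
move=> k0; apply/eqP; rewrite eqEsubv -!memvE memvZ ?memv_line//=.
by rewrite -[L in L \in _](scalerK k0) memvZ// memv_line.
Qed.

Lemma vline_eq L M : L != 0 -> <[L]>%VS = <[M]>%VS ->
  exists2 k, k != 0 & L = k *: M.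
Proof.
move=> L0 e; have /vlineP[k ek] : L \in <[M]>%VS by rewrite -e memv_line.
by exists k => //; apply: contra_neq L0 => k0; rewrite ek k0 scale0r.
Qed.

Lemma root_pair_rep p z w : root_pair p = upair z w ->
  exists2 k, k != 0 & pt_rep p = k *: pair_mx z w.
Proof.
have [vp _ p0] := pt_repP p => /root_pairP e.
by apply: vline_eq => //; rewrite -vp.
Qed.

Lemma conjc_eq0 k : (conjc k == 0) = (k == 0).
Proof. by case: k => x y; rewrite !eq_complex /= oppr_eq0. Qed.

Lemma mxconjZ k L : mxconj (k *: L) = conjc k *: mxconj L.
Proof. by apply/matrixP => i j; rewrite !mxE rmorphM. Qed.

Lemma mxconj_sl2mx (a b c : C) :
  mxconj (sl2mx a b c) = sl2mx (conjc a) (conjc b) (conjc c).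
Proof. by apply: matrix2P; rewrite !mxE //= rmorphN. Qed.

Lemma mxconj_pair z w : mxconj (pair_mx z w) = pair_mx (CP1_conj z) (CP1_conj w).
Proof.
case: z w => [x|] [y|] /=; rewrite mxconj_sl2mx ?rmorph1 ?rmorph0 ?rmorphN ?rmorph1 //.
- by rewrite !rmorphM rmorphD fmorphV rmorph_nat.
- by rewrite rmorphM fmorphV rmorph_nat rmorph1.
- by rewrite rmorphM fmorphV rmorph_nat rmorph1.
Qed.

Lemma CP1_conj_fix z : CP1_conj z = z <-> RP1 z.
Proof.
case: z => [[x y]|]//; rewrite /RP1 /=; split=> [[/eqP]|->]; last by rewrite oppr0.
by rewrite eqNr => /eqP.
Qed.

Lemma CP1_conjK : involutive (@CP1_conj R).
Proof. by case=> //= x; rewrite conjcK. Qed.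

Lemma real_pairsP z w : real_pairs (upair z w) <->
  (RP1 z /\ RP1 w) \/ z = CP1_conj w.
Proof.
split=> [[z' [w' [/upairP[[-> ->]|[-> ->]]]]]//|h]; last by exists z, w.
by move=> [[]|->]; [left|right; rewrite CP1_conjK].
Qed.

Lemma one_real_pairsP z w : one_real_pairs (upair z w) <->
  (RP1 z /\ ~ RP1 w) \/ (~ RP1 z /\ RP1 w).
Proof.
split=> [[z' [w' [/upairP[[-> ->]|[-> ->]]]]]|[[? ?]|[? ?]]].
- by left.
- by right.
- by exists z, w.
- by exists w, z; split=> //; apply/upairP; right.
Qed.

Lemma real_pts_rep p z w : root_pair p = upair z w ->
  real_pts p <-> real_pairs (upair z w).
Proof.
move=> e; have [k k0 ek] := root_pair_rep e; have [vp _ p0] := pt_repP p.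
have -> : real_pts p <-> root_pair p = upair (CP1_conj z) (CP1_conj w).
  rewrite root_pairP vp /real_pts /= ek mxconjZ mxconj_pair.
  by rewrite [X in _ = X <-> _]vline_scale// conjc_eq0.
rewrite e upairP real_pairsP -!CP1_conj_fix.
split=> [[[h1 h2]|[-> _]]|[[-> ->]|->]].
- by left.
- by right.
- by left.
- by right; rewrite CP1_conjK.
Qed.

Lemma span2P L M (X : 'M[C]_2) :
  X \in <<[:: L; M]>>%VS <-> exists a b, X = a *: L + b *: M.
Proof.
rewrite span_cons span_seq1; split=> [/memv_addP[u /vlineP[a ->] [v /vlineP[b ->] ->]]|].
  by exists a, b.
by move=> [a [b ->]]; rewrite memv_add// memvZ// memv_line.
Qed.

Definition bracket_closed L M : Prop :=
  exists a b, comm2 L M = a *: L + b *: M.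

Lemma degenerate_ptsE p z w : root_pair p = upair z w ->
  degenerate_pts p <->
  bracket_closed (pair_mx z w) (pair_mx (CP1_conj z) (CP1_conj w)).
Proof.
move=> e; have [k k0 ek] := root_pair_rep e.
have k0' : conjc k != 0 by rewrite conjc_eq0.
set M := pair_mx z w in ek *; set M' := pair_mx _ _.
have spanE X : X \in <<[:: pt_rep p; mxconj (pt_rep p)]>>%VS <->
    exists a b, X = a *: M + b *: M'.
  rewrite ek mxconjZ mxconj_pair -/M' span2P; split=> [] [a [b ->]].
    by exists (a * k), (b * conjc k); rewrite !scalerA.
  by exists (a / k), (b / conjc k); rewrite !scalerA !mulfVK.
split=> [h|[a [b h]]]; last first.
  move=> /= X Y /spanE[x1 [x2 ->]] /spanE[y1 [y2 ->]].
  apply/spanE; exists ((x1 * y2 - x2 * y1) * a), ((x1 * y2 - x2 * y1) * b).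
  by rewrite -/(comm2 _ _) comm2_span h scalerDr !scalerA.
apply/spanE; apply: h; apply/spanE.
  by exists 1, 0; rewrite scale1r scale0r addr0.
by exists 0, 1; rewrite scale1r scale0r add0r.
Qed.

(** Matrices with a common root lie in the Borel subalgebra fixing it; their
    bracket is proportional to the nilpotent matrix with this double root. *)
Lemma common_root_closed (x y y' : C) :
  bracket_closed (pair_mx (Some x) (Some y)) (pair_mx (Some x) (Some y')).
Proof.
exists (y' - x), (x - y).
by apply: matrix2P; rewrite comm2E !mxE /=; field.
Qed.

Lemma common_infinity_closed (y y' : C) :
  bracket_closed (pair_mx None (Some y)) (pair_mx None (Some y')).
Proof.
exists (- 1), 1.
by apply: matrix2P; rewrite comm2E !mxE /=; field.
Qed.

(** The left-hand side is the resultant of the two root polynomials. *)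
Lemma closed_common_root (x y x' y' : C) :
  bracket_closed (pair_mx (Some x) (Some y)) (pair_mx (Some x') (Some y')) ->
  (x - x') * (x - y') * (y - x') * (y - y') = 0.
Proof.
move=> [a [b e]].
have E i j := congr1 (fun M : 'M[C]_2 => M i j) e.
have := E 1 0; have := E 0 0; have := E 0 1; rewrite !comm2E !mxE /= => e3 e2 e1.
rewrite resultant_midpoints ?pnatr_eq0//.
apply: (@bracket_elimination _ _ _ _ _ a b).
- by transitivity (a * 1 + b * 1); [rewrite -e1|]; ring.
- by rewrite -e2; ring.
- by transitivity (a * - (x * y) + b * - (x' * y')); [rewrite -e3|]; ring.
Qed.

Lemma one_real_bracket_closed z w : RP1 z -> ~ RP1 w ->
  bracket_closed (pair_mx z w) (pair_mx (CP1_conj z) (CP1_conj w)).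
Proof.
move=> /CP1_conj_fix ->; case: w => [y _|/(_ I)//]; case: z => [x|].
- exact: common_root_closed.
- exact: common_infinity_closed.
Qed.

Lemma bracket_closedC z w z' w' :
  bracket_closed (pair_mx z w) (pair_mx z' w') <->
  bracket_closed (pair_mx w z) (pair_mx w' z').
Proof. by rewrite [pair_mx z w]pair_mxC [pair_mx z' w']pair_mxC. Qed.

(** If the pencil of L and its conjugate is closed, the two root pairs
    {x, y} and {conj x, conj y} meet: a root is real or the roots are conjugate. *)
Lemma degenerate_not_real p z w : root_pair p = upair z w -> ~ real_pts p ->
  degenerate_pts p <-> one_real_pairs (upair z w).
Proof.
move=> e; rewrite (real_pts_rep e) real_pairsP (degenerate_ptsE e) one_real_pairsP.
move=> /not_orP[nr nc]; split=> [h|[[hz hw]|[hz hw]]]; last first.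
- by apply/bracket_closedC; exact: one_real_bracket_closed.
- exact: one_real_bracket_closed.
case: (pselect (RP1 z)) => hz; case: (pselect (RP1 w)) => hw.
- by case: nr.
- by left.
- by right.
case: z w hz hw nc h {e nr} => [x|] [y|] //= hz hw nc h.
have /eqP := closed_common_root h; rewrite !mulf_eq0 !subr_eq0.
have nfix (v : C) : ~ RP1 (Some v) -> (v == conjc v) = false.
  by move=> hv; apply/negP => /eqP ev; apply: hv; apply/CP1_conj_fix; rewrite /= -ev.
rewrite !nfix// orbF /= => /orP[/eqP xy|/eqP yx].
- by case: nc; rewrite -xy.
- by case: nc; rewrite yx conjcK.
Qed.

Lemma regular_pts_rep p z w : root_pair p = upair z w ->
  regular_pts p <-> exists x y,
    [/\ z = Some x, w = Some y, Im x != 0, Im y != 0 & x != conjc y].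
Proof.
move=> e; split=> [|[x [y [ez ew /eqP x0 /eqP y0 /eqP xy]]]]; last first.
  have nr : ~ real_pts p.
    by rewrite (real_pts_rep e) real_pairsP ez ew => -[[]//|[]].
  move=> [//|]; rewrite (degenerate_not_real e nr) one_real_pairsP ez ew.
  by move=> [[]|[]].
move=> /not_orP[nr]; rewrite (degenerate_not_real e nr) one_real_pairsP.
move: nr; rewrite (real_pts_rep e) real_pairsP => /not_orP[nr nc] /not_orP[n1 n2].
have hz : ~ RP1 z by move=> hz; have [hw|hw] := pselect (RP1 w); [apply: nr|apply: n1].
have hw : ~ RP1 w by move=> hw; apply: n2.
case: z w hz hw nc {e nr n1 n2} => [x|] [y|] //= /eqP hz /eqP hw nc.
by exists x, y; split=> //; apply/eqP => xy; apply: nc; rewrite xy.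
Qed.

Lemma regular_ptsE p : regular_pts p <-> regular_mx (pt_rep p).
Proof.
have [z [w e]] := upair_exists (root_pair p).
have [k k0 ->] := root_pair_rep e.
by rewrite (regular_pts_rep e) regular_mxZ// regular_mx_pair.
Qed.

End Points.

(** Equivariance of the parametrization of matrices by their roots, with the
    factor of proportionality. *)
Lemma moebius_pair (T : fieldType) (a b c d s s' z w : T) : 2 != 0 :> T ->
  c * s + d != 0 -> c * s' + d != 0 ->
  z * (c * s + d) = a * s + b -> w * (c * s' + d) = a * s' + b ->
  let P u v := mx2 ((u + v) / 2) (- (u * v)) 1 (- ((u + v) / 2)) in
  (a * d - b * c) *: (mx2 a b c d *m P s s') =
  ((c * s + d) * (c * s' + d)) *: (P z w *m mx2 a b c d).
Proof.
move=> two n n' /(canRL (mulfK n)) -> /(canRL (mulfK n')) -> P.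
by apply: mx2P; rewrite [LHS]mxE [RHS]mxE !mulmx2E !mx2E; field; rewrite two n n'.
Qed.

Lemma conj2_mul (T : comUnitRingType) (g h X : 'M[T]_2) :
  g \in unitmx -> h \in unitmx -> conj2 (g *m h) X = conj2 g (conj2 h X).
Proof.
move=> gu hu; have ghu : g *m h \in unitmx by rewrite unitmx_mul gu.
apply: (can_inj (mulmxK ghu)); rewrite /conj2 mulmxKV//.
by rewrite !mulmxA mulmxKV// mulmxKV.
Qed.

Lemma conj2K (T : comUnitRingType) (g X : 'M[T]_2) :
  g \in unitmx -> conj2 (invmx g) (conj2 g X) = X.
Proof.
move=> gu; rewrite -conj2_mul ?unitmx_inv// mulVmx//.
by rewrite /conj2 mul1mx invmx1 mulmx1.
Qed.

(** * Invariance along orbits and transitivity *)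

Section Orbits.
Variable R : realType.
Local Notation C := (R[i]).
Local Notation Re := (@complex.Re R).
Local Notation Im := (@complex.Im R).
Local Notation mxRe := (map_mx Re).
Local Notation mxIm := (map_mx Im).
Local Notation toC := (map_mx (real_complex R)).
Local Notation Psl2C := (Psl2C R).
Implicit Types (L M : 'M[C]_2) (X Y g h : 'M[R]_2) (k : C) (p q : Psl2C).

Lemma mxReIm_inj L M : mxRe L = mxRe M -> mxIm L = mxIm M -> L = M.
Proof.
move=> /matrixP e1 /matrixP e2; apply/matrixP => i j; apply/eqP.
have := e1 i j; have := e2 i j; rewrite !mxE => i1 i2.
by rewrite eq_complex i1 i2 !eqxx.
Qed.

Lemma Re_complexify (f : 'M[R]_2 -> 'M[R]_2) L :
  mxRe (complexify f L) = f (mxRe L).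
Proof.
by apply/matrixP => i j; rewrite !mxE /= !mul0r mulr0 subrr addr0.
Qed.

Lemma Im_complexify (f : 'M[R]_2 -> 'M[R]_2) L :
  mxIm (complexify f L) = f (mxIm L).
Proof.
by apply/matrixP => i j; rewrite !mxE /= mul0r mul1r !add0r.
Qed.

Lemma trace_ReIm L : \tr L = 0 -> \tr (mxRe L) = 0 /\ \tr (mxIm L) = 0.
Proof. by move=> /mxtrace2_eq0 h; split; apply/mxtrace2_eq0; rewrite !mxE h; case: (L 0 0). Qed.

Lemma pt_rep_trace p : \tr (pt_rep p) = 0.
Proof. by have [_ + _] := pt_repP p; rewrite mem_sl2C => /eqP h; apply/mxtrace2_eq0. Qed.

(** What remains of the differential of an automorphism: an injective map of
    sl2(R) into itself preserving the determinant. *)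
Definition killing_isometry (A : 'M[R]_2 -> 'M[R]_2) :=
  forall X, \tr X = 0 -> [/\ \tr (A X) = 0, A X = 0 -> X = 0 & \det (A X) = \det X].

Lemma complexify_scale (A : {linear 'M[R]_2 -> 'M[R]_2}) k L :
  complexify A (k *: L) = k *: complexify A L.
Proof.
have ReZ M : mxRe (k *: M) = Re k *: mxRe M - Im k *: mxIm M.
  by apply/matrixP => i j; rewrite !mxE; case: (k) (M i j) => [? ?] [].
have ImZ M : mxIm (k *: M) = Re k *: mxIm M + Im k *: mxRe M.
  by apply/matrixP => i j; rewrite !mxE; case: (k) (M i j) => [? ?] [? ?].
by apply: mxReIm_inj; rewrite ?ReZ ?ImZ !(Re_complexify, Im_complexify) ?ReZ ?ImZ
  ?raddfB ?raddfD /= !linearZ_LR.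
Qed.

Lemma complexify_conj (A : {linear 'M[R]_2 -> 'M[R]_2}) L :
  complexify A (mxconj L) = mxconj (complexify A L).
Proof.
have ReC M : mxRe (mxconj M) = mxRe M.
  by apply/matrixP => i j; rewrite !mxE conjcE.
have ImC M : mxIm (mxconj M) = - mxIm M.
  by apply/matrixP => i j; rewrite !mxE conjcE.
by apply: mxReIm_inj; rewrite ?ReC ?ImC !(Re_complexify, Im_complexify) ?ReC ?ImC ?raddfN.
Qed.

Lemma complexify_inj (A : {linear 'M[R]_2 -> 'M[R]_2}) L M : killing_isometry A ->
  \tr L = 0 -> \tr M = 0 -> complexify A L = complexify A M -> L = M.
Proof.
move=> iA trL trM e; have [t1 t2] := trace_ReIm trL; have [t3 t4] := trace_ReIm trM.
have key X Y : \tr X = 0 -> \tr Y = 0 -> A X = A Y -> X = Y.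
  move=> tX tY eXY; apply/eqP; rewrite -subr_eq0; apply/eqP.
  have [|_ h _] := iA (X - Y); first by rewrite raddfB /= tX tY subrr.
  by apply: h; rewrite raddfB /= eXY subrr.
by apply: mxReIm_inj; apply: key => //;
  [rewrite -!Re_complexify e|rewrite -!Im_complexify e].
Qed.

Lemma complexify_trace A L : killing_isometry A -> \tr L = 0 ->
  \tr (complexify A L) = 0.
Proof.
move=> iA /trace_ReIm[t1 t2]; have [e1 _ _] := iA _ t1; have [e2 _ _] := iA _ t2.
have -> M : \tr M = Complex (\tr (mxRe M)) (\tr (mxIm M)).
  by rewrite !mxtrace2E !mxE; case: (M 0 0) (M 1 1) => [? ?] [? ?].
by rewrite Re_complexify Im_complexify e1 e2.
Qed.

Lemma hform_complexify A L : killing_isometry A -> \tr L = 0 ->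
  hform (complexify A L) = hform L.
Proof.
move=> iA tL; have [t1 t2] := trace_ReIm tL.
rewrite !hform_det ?complexify_trace// Re_complexify Im_complexify.
by have [_ _ ->] := iA _ t1; have [_ _ ->] := iA _ t2.
Qed.

Lemma qform_complexify (A : {linear 'M[R]_2 -> 'M[R]_2}) L : killing_isometry A ->
  \tr L = 0 -> nrm2 (qform (complexify A L)) = nrm2 (qform L).
Proof.
move=> iA tL; have [t1 t2] := trace_ReIm tL.
rewrite !qform_det ?complexify_trace// Re_complexify Im_complexify -raddfD.
have [_ _ ->] := iA _ t1; have [_ _ ->] := iA _ t2.
by have [|_ _ ->] := iA (mxRe L + mxIm L); rewrite // raddfD /= t1 t2 addr0.
Qed.

(** The differential is only constrained on traceless matrices, and there it
    agrees with a linear map A of all matrices, which replaces it from here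
    on. *)
Lemma orbit_rep p q : Defs.orbit p q ->
  exists2 A : {linear 'M[R]_2 -> 'M[R]_2}, killing_isometry A &
  exists2 k, k != 0 & pt_rep q = k *: complexify A (pt_rep p).
Proof.
move=> [phi /lie_autP[A hA] e].
have iA : killing_isometry A by move=> X /hA[].
exists A => //; have tp := pt_rep_trace p; have [t1 t2] := trace_ReIm tp.
have [vp _ p0] := pt_repP p; have [vq _ q0] := pt_repP q.
have : [set` val q] (complexify (lie_diff phi) (pt_rep p)).
  by rewrite e; exists (pt_rep p) => //=; rewrite vp memv_line.
have -> : complexify (lie_diff phi) (pt_rep p) = complexify A (pt_rep p).
  apply: mxReIm_inj; rewrite !(Re_complexify, Im_complexify).
    by have [] := hA _ t1.
  by have [] := hA _ t2.
rewrite /= vq => /vlineP[k ek].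
have k0 : k != 0.
  apply: contra_neq p0 => k0; apply: (complexify_inj iA) => //.
    by rewrite raddf0.
  by rewrite ek k0 -(scale0r (pt_rep p)) complexify_scale !scale0r.
by exists k^-1; rewrite ?invr_eq0// ek scalerK.
Qed.

Lemma orbit_regular p q : Defs.orbit p q -> regular_pts p <-> regular_pts q.
Proof.
move=> /orbit_rep[A iA [k k0 e]]; rewrite !regular_ptsE e regular_mxZ//.
by rewrite /regular_mx hform_complexify ?qform_complexify// pt_rep_trace.
Qed.

Lemma orbit_form_rel (t : R) p q : Defs.orbit p q ->
  form_rel t (pt_rep p) <-> form_rel t (pt_rep q).
Proof.
move=> /orbit_rep[A iA [k k0 ->]]; rewrite form_relZ//.
by rewrite /form_rel hform_complexify ?qform_complexify// pt_rep_trace.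
Qed.

Lemma real_ptsE p : real_pts p <-> exists k, mxconj (pt_rep p) = k *: pt_rep p.
Proof.
have [vp _ p0] := pt_repP p; split=> [/= h|[k e]].
  apply/vlineP; have := memv_line (mxconj (pt_rep p)).
  by rewrite -h.
rewrite /real_pts /= e vline_scale//; apply: contra_neq p0 => k0.
have := congr1 (@mxconj R) e; rewrite k0 scale0r.
have mxconjK L : mxconj (mxconj L) = L.
  by apply/matrixP => i j; rewrite !mxE conjcK.
rewrite mxconjK => ->; apply/matrixP => i j; rewrite !mxE.
exact: rmorph0.
Qed.

Lemma mxconj_trace L : \tr L = 0 -> \tr (mxconj L) = 0.
Proof. by move=> /mxtrace2_eq0 h; apply/mxtrace2_eq0; rewrite !mxE h rmorphN. Qed.

Lemma orbit_real p q : Defs.orbit p q -> real_pts p <-> real_pts q.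
Proof.
move=> /orbit_rep[A iA [k k0 e]]; rewrite !real_ptsE e.
have tp := pt_rep_trace p.
split=> [[l el]|[l]].
  exists (conjc k * l / k); rewrite mxconjZ -complexify_conj el complexify_scale.
  by rewrite !scalerA mulfVK.
rewrite mxconjZ -complexify_conj scalerA -!complexify_scale => el.
have k0' : conjc k != 0 by rewrite conjc_eq0.
exists (l * k / conjc k).
have := complexify_inj iA _ _ el; rewrite !linearZ /= mxconj_trace// tp !mulr0.
move=> /(_ erefl erefl) h; apply: (scalerI k0').
by rewrite h scalerA [conjc k * _]mulrC mulfVK.
Qed.
Lemma complexify_conj2 h L : h \in unitmx -> \tr L = 0 ->
  complexify (lie_diff (conj2 h)) L = conj2 (toC h) L.
Proof.
move=> hu /trace_ReIm[t1 t2].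
rewrite /complexify !lie_diff_conj// /conj2 !map_mxM /= !map_invmx.
rewrite scalemxAl scalemxAr -mulmxDl -mulmxDr; congr (_ *m _ *m _).
apply/matrixP => i j; rewrite !mxE.
by case: (L i j) => x y /=; apply/eqP; rewrite eq_complex /=;
  apply/andP; split; apply/eqP; ring.
Qed.

Lemma orbit_conj h p q : h \in unitmx ->
  val q = <[conj2 (toC h) (pt_rep p)]>%VS -> Defs.orbit p q.
Proof.
move=> hu e; have [vp _ p0] := pt_repP p; have tp := pt_rep_trace p.
exists (conj2 h); first exact: lie_aut_conj.
have E k : complexify (lie_diff (conj2 h)) (k *: pt_rep p) =
    k *: conj2 (toC h) (pt_rep p).
  rewrite complexify_conj2//; last by rewrite linearZ /= tp mulr0.
  by rewrite /conj2 -scalemxAr -scalemxAl.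
apply/seteqP; split=> X /=; rewrite ?e ?vp.
  by move=> /vlineP[k ->]; exists (k *: pt_rep p); rewrite ?E//= memvZ// memv_line.
by move=> [Y /vlineP[k ->]] <-; rewrite E memvZ// memv_line.
Qed.

Lemma orbit_refl p : Defs.orbit p p.
Proof.
apply: (@orbit_conj 1%:M); first exact: unitmx1.
have [vp _ _] := pt_repP p.
by rewrite /conj2 map_mx1 invmx1 mul1mx mulmx1.
Qed.

Lemma mx2_unit (a b c d : R) : a * d - b * c != 0 -> mx2 a b c d \in unitmx.
Proof. by move=> D0; rewrite unitmxE det2E !mx2E unitfE. Qed.

Lemma toC_mx2 (a b c d : R) :
  toC (mx2 a b c d) = mx2 (real_complex R a) (real_complex R b)
    (real_complex R c) (real_complex R d).
Proof. by apply: mx2P; rewrite !mxE. Qed.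

Lemma sl2mx_mx2 (x y z : C) : sl2mx x y z = mx2 x y z (- x).
Proof. by apply: mx2P; rewrite !mxE. Qed.

Lemma moves_complex (a b c d s : R) (z : C) : moves a b c d s z ->
  z * (real_complex R c * Complex 0 s + real_complex R d) =
  real_complex R a * Complex 0 s + real_complex R b.
Proof.
case: z => x y [/= h1 h2]; apply/eqP; rewrite eq_complex /=.
by apply/andP; split; apply/eqP; [rewrite -h1|transitivity (a * s); rewrite -?h2]; ring.
Qed.

Lemma denom_complex (a b c d s : R) (z : C) : moves a b c d s z ->
  a * d - b * c != 0 -> s != 0 ->
  real_complex R c * Complex 0 s + real_complex R d != 0.
Proof.
move=> m D0 s0; rewrite -nrm2_eq0 /nrm2 /=.
rewrite (_ : _ + _ = d ^+ 2 + (c * s) ^+ 2); last by ring.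
by rewrite lt0r_neq0// (moves_denom m).
Qed.

Lemma normal_pair_conj2 (z w : C) (t : R) : t != 0 -> normal_pair z w t ->
  exists2 g, g \in unitmx & exists2 k, k != 0 &
    conj2 (toC g) (pair_mx (Some (Complex 0 1)) (Some (Complex 0 t))) =
    k *: pair_mx (Some z) (Some w).
Proof.
move=> t0 [a [b [c [d [D0 mz mw]]]]]; have gu := mx2_unit D0.
exists (mx2 a b c d) => //.
have two : (2 : C) != 0 by rewrite pnatr_eq0.
have n1 := denom_complex mz D0 (oner_neq0 R).
have n2 := denom_complex mw D0 t0.
have := moebius_pair two n1 n2 (moves_complex mz) (moves_complex mw).
rewrite -toC_mx2 /= -!sl2mx_mx2.
set D := (_ * _ - _ * _); have D0' : D != 0.
  by rewrite /D -!rmorphM -rmorphB fmorph_eq0.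
pose K := (real_complex R c * Complex 0 1 + real_complex R d) *
  (real_complex R c * Complex 0 t + real_complex R d).
have K0 : K != 0 by exact: mulf_neq0.
rewrite -/K => e; exists (K / D); first by rewrite mulf_neq0// invr_eq0.
have guC : toC (mx2 a b c d) \in unitmx by rewrite map_unitmx.
apply: (can_inj (mulmxK guC)); rewrite /conj2 mulmxKV//.
apply: (scalerI D0'); rewrite -scalemxAl scalerA [D * _]mulrC mulfVK// e.
Qed.

(** Both points are moved from the normal form, by g and g'; conjugation by
    g' g^-1 sends the first to the second. *)
Lemma orbit_normal_pair p q (z w z' w' : C) (t : R) : t != 0 ->
  root_pair p = upair (Some z) (Some w) ->
  root_pair q = upair (Some z') (Some w') ->
  normal_pair z w t -> normal_pair z' w' t -> Defs.orbit p q.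
Proof.
move=> t0 ep eq /(normal_pair_conj2 t0)[g gu [k k0 e]] /(normal_pair_conj2 t0)[g' gu' [k' k0' e']].
have gu_inv : invmx g \in unitmx by rewrite unitmx_inv.
apply: (@orbit_conj (g' *m invmx g)); first by rewrite unitmx_mul gu'.
have [l l0 ->] := root_pair_rep ep.
have /root_pairP -> := eq.
have conj2Z (h X : 'M[C]_2) (x : C) : conj2 h (x *: X) = x *: conj2 h X.
  by rewrite /conj2 -scalemxAr -scalemxAl.
have guC : toC g \in unitmx by rewrite map_unitmx.
rewrite map_mxM map_invmx conj2_mul ?unitmx_inv ?map_unitmx//.
rewrite -(scalerK k0 (pair_mx (Some z) (Some w))) -e !conj2Z.
rewrite conj2K// e' !vline_scale//.
  by rewrite invr_eq0.
Qed.

(** One inclusion is the invariance of h / |q|, the other the transitivity of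
    GL2(R) on pairs of the same parameter. *)
Lemma root_pair_orbit p (t : R) : 1 <= `|t| ->
  regular_pts p -> orbit_pairs t (root_pair p) ->
  (@root_pair R) @` Defs.orbit p = orbit_pairs t.
Proof.
move=> t1 rp tp; have t0 := norm_ge1_neq0 t1.
have [z [w [ep h]]] := tp.
apply/seteqP; split=> s.
  move=> [q oq <-]; have /(orbit_regular oq) rq := rp.
  have [z' [w' eq]] := upair_exists (root_pair q).
  have [x [y [ez ew x0 y0 xy]]] := (regular_pts_rep eq).1 rq.
  rewrite eq ez ew; apply/orbit_pairsP => //; split=> //; apply/form_rel_pair.
  have [k k0 ek] := root_pair_rep eq; rewrite -ez -ew -(form_relZ t _ k0) -ek.
  apply/(orbit_form_rel t oq).
  have [l l0 ->] := root_pair_rep ep; apply/(form_relZ t _ l0)/form_rel_pair.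
  exact: normal_pair_invariant.
move=> [z' [w' [-> h']]].
have [f _ fK] := @root_pair_bij R.
exists (f (upair (Some z') (Some w'))) => //.
exact: (orbit_normal_pair t0 ep (fK _) h h').
Qed.

Lemma param_range (t : R) : 1 <= t \/ t < - 1 -> 1 <= `|t| /\ t + 1 != 0.
Proof.
move=> ht; split; last by apply/eqP => et; case: ht => ht; lra.
by case: ger0P => t0; case: ht => ht; lra.
Qed.

Lemma regular_normal_pair p : regular_pts p -> exists2 t : R,
  1 <= t \/ t < - 1 & orbit_pairs t (root_pair p).
Proof.
have [z' [w' e]] := upair_exists (root_pair p).
move=> /(regular_pts_rep e)[z [w [ez ew z0 w0 zw]]].
have [t t1 h] := normal_pair_exists z0 w0; exists t; last first.
  by rewrite e ez ew; exists z, w.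
have [tp|tn] := ger0P t; first by left; rewrite ger0_norm in t1.
right; rewrite ltr0_norm// in t1; rewrite lt_neqAle lerNr t1 andbT.
apply: contra_neq zw => et; have := normal_pair_conjr h; rewrite et opprK => h'.
have := normal_pair_invariant (oner_neq0 R) h'.
rewrite subrr expr0n mul0r mulr1 => /eqP.
by rewrite nrm2_eq0 subr_eq0 => /eqP.
Qed.

Lemma normal_pair_regular p (t : R) : 1 <= t \/ t < - 1 ->
  orbit_pairs t (root_pair p) -> regular_pts p.
Proof.
move=> ht [z [w [e h]]]; apply/(regular_pts_rep e); exists z, w.
have [t1 tn1] := param_range ht; have t0 := norm_ge1_neq0 t1.
have [z0 w0] := normal_pair_nonreal t0 h.
split=> //; apply/eqP => zw.
have tn0 : - t != 0 by rewrite oppr_eq0.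
have := normal_pair_invariant tn0 (normal_pair_conjr h).
rewrite -zw subrr /nrm2 /= expr0n addr0 mul0r => /esym/eqP.
rewrite !mulf_eq0 (negbTE z0) !orbF orbb.
by rewrite -opprD oppr_eq0 (negbTE tn1).
Qed.

End Orbits.

(** * Submanifolds of R^4 cut out by polynomials *)

Section SmoothPolynomials.
Variable R : realType.
Local Notation V := 'rV[R]_4.

(** Polynomials in four real coordinates as syntax, so that smoothness and the
    values of partial derivatives are obtained by recursion. *)
Inductive polyexp :=
  | Coord of 'I_4
  | Const of R
  | Add of polyexp & polyexp
  | Mul of polyexp & polyexp.

Fixpoint peval (e : polyexp) (x : V) : R :=
  match e with
  | Coord i => x 0 i
  | Const c => c
  | Add e1 e2 => peval e1 x + peval e2 x
  | Mul e1 e2 => peval e1 x * peval e2 x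
  end.

Fixpoint pder (e : polyexp) (x v : V) : R :=
  match e with
  | Coord i => v 0 i
  | Const _ => 0
  | Add e1 e2 => pder e1 x v + pder e2 x v
  | Mul e1 e2 => pder e1 x v * peval e2 x + peval e1 x * pder e2 x v
  end.

Lemma Ck_continuous (W1 W2 : normedModType R) k (f : W1 -> W2) :
  Ck k setT f -> continuous f.
Proof.
case: k => [h x|k [h _] x]; first exact: h.
exact/differentiable_continuous/h.
Qed.

Lemma Ck_sub (W1 W2 : normedModType R) k (U U' : set W1) (f : W1 -> W2) :
  U `<=` U' -> Ck k U' f -> Ck k U f.
Proof.
move=> UU'; elim: k f => [|k IH] f /=; first by move=> h x /UU'; exact: h.
by move=> [h1 h2]; split=> [x /UU'/h1//|v]; exact/IH/h2.
Qed.

Lemma Ck_le (W1 W2 : normedModType R) k (U : set W1) (f : W1 -> W2) :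
  Ck k.+1 U f -> Ck k U f.
Proof.
elim: k f => [|k IH] f [h1 h2]; first by move=> x /h1/differentiable_continuous.
by split=> // v; exact/IH/h2.
Qed.

Lemma CkD (W : normedModType R) k (f g : W -> R) :
  Ck k setT f -> Ck k setT g -> Ck k setT (f + g).
Proof.
elim: k f g => [|k IH] f g /=.
  by move=> cf cg x _; apply: continuousD; [exact: cf|exact: cg].
move=> [df Df] [dg Dg]; split=> [x _|v].
  by apply: differentiableD; [exact: df|exact: dg].
rewrite (_ : (fun _ => _) = (fun x => 'D_v f x) + (fun x => 'D_v g x)).
  exact: IH.
by apply/funext => x; rewrite deriveD//; apply: diff_derivable; [exact: df|exact: dg].
Qed.

Lemma CkM (W : normedModType R) k (f g : W -> R) :
  Ck k setT f -> Ck k setT g -> Ck k setT (f * g).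
Proof.
elim: k f g => [|k IH] f g.
  by move=> cf cg x _; apply: continuousM; [exact: cf|exact: cg].
move=> Cf Cg; have [df Df] := Cf; have [dg Dg] := Cg; split=> [x _|v].
  by apply: differentiableM; [exact: df|exact: dg].
rewrite (_ : (fun _ => _) = (f * (fun x => 'D_v g x)) + (g * (fun x => 'D_v f x))).
  by apply: CkD; apply: IH; [exact: Ck_le Cf|exact: Dg|exact: Ck_le Cg|exact: Df].
by apply/funext => x; rewrite deriveM//; apply: diff_derivable; [exact: df|exact: dg].
Qed.

Lemma is_derive_coord (x v : V) i : is_derive x v (fun y : V => y 0 i : R) (v 0 i).
Proof.
have dc := differentiable_coord x 0 i.
apply: DeriveDef; first exact: diff_derivable.
have := derive_mx (@derivable_id R V x v); rewrite derive_id => /matrixP/(_ 0 i).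
by rewrite mxE => ->.
Qed.

Lemma is_derive_peval e (x v : V) : is_derive x v (peval e) (pder e x v).
Proof.
elim: e => [i|c|e1 IH1 e2 IH2|e1 IH1 e2 IH2] /=.
- exact: is_derive_coord.
- exact: is_derive_cst.
- exact: is_deriveD.
- apply: (is_derive_ext (is_deriveM IH1 IH2)) => //.
  by rewrite /GRing.scale /= addrC [peval e2 x * _]mulrC.
Qed.

Lemma peval_smooth e (U : set V) : smooth_on U (peval e).
Proof.
move=> k; apply: (@Ck_sub _ _ _ _ setT) => //.
elim: e => [i|c|e1 IH1 e2 IH2|e1 IH1 e2 IH2] /=.
- case: k => [|k] /=; first by move=> x _; exact: coord_continuous.
  split=> [x _|v]; first exact: differentiable_coord.
  rewrite (_ : (fun _ => _) = cst (v 0 i)); first exact: Ck_cst.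
  by apply/funext => x; have [_ ->] := is_derive_coord x v i.
- exact: Ck_cst.
- exact: CkD.
- exact: CkM.
Qed.

Lemma peval_continuous e : continuous (peval e).
Proof. exact: (Ck_continuous (peval_smooth e setT 0%N)). Qed.

Lemma open_pos e : open [set x : V | 0 < peval e x].
Proof.
rewrite (_ : mkset _ = peval e @^-1` [set r | 0 < r]) //.
by apply: open_comp; [move=> x _; exact: peval_continuous|exact: open_gt].
Qed.

(** The inequality describes an open set, which serves as the neighbourhood of
    all points of S at once. *)
Lemma hypersurface (S : set V) (F G : polyexp) :
  (forall x, S x <-> peval F x = 0 /\ 0 < peval G x) ->
  (forall x, S x -> exists i, pder F x (delta_mx 0 i) != 0) ->
  submanifold_codim 1 S.
Proof.
move=> SE reg x Sx; exists [set y | 0 < peval G y], (fun=> peval F); split.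
- exact: open_pos.
- by have [] := (SE x).1 Sx.
- by move=> _; exact: peval_smooth.
- move=> y Gy; split=> [/SE[-> //]|h]; apply/SE; split=> //.
  exact: (h ord0).
have [j Fj] := reg _ Sx.
apply: inj_row_free => v /matrixP/(_ 0 j); rewrite !mxE big_ord1 !mxE.
have [_ ->] := is_derive_peval F x (delta_mx 0 j).
move=> /eqP; rewrite mulf_eq0 (negbTE Fj) orbF => /eqP v0.
by apply/matrixP => a b; rewrite mxE !ord1.
Qed.

Lemma codim2_zero_set (S : set V) (F1 F2 G : polyexp) :
  (forall x, S x <-> [/\ peval F1 x = 0, peval F2 x = 0 & 0 < peval G x]) ->
  (forall x, S x -> forall a b : R, (forall i,
    a * pder F1 x (delta_mx 0 i) + b * pder F2 x (delta_mx 0 i) = 0) ->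
    a = 0 /\ b = 0) ->
  submanifold_codim 2 S.
Proof.
move=> SE reg x Sx; exists [set y | 0 < peval G y],
  (fun i => if i == 0 then peval F1 else peval F2); split.
- exact: open_pos.
- by have [] := (SE x).1 Sx.
- by move=> i; case: ifP => _; exact: peval_smooth.
- move=> y Gy; split=> [/SE[e1 e2 _] i|h]; first by case: ifP.
  by apply/SE; split=> //; [have := h 0|have := h 1].
apply: inj_row_free => v vM.
have [|a0 b0] := reg _ Sx (v 0 0) (v 0 1).
  move=> j; have := congr1 (fun M : V => M 0 j) vM.
  rewrite !mxE !big_ord_recl big_ord0 addr0 !mxE /=.
  have [_ ->] := is_derive_peval F1 x (delta_mx 0 j).
  have [_ ->] := is_derive_peval F2 x (delta_mx 0 j).
  by have -> : lift ord0 ord0 = 1 :> 'I_2 by exact/val_inj.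
by apply/matrixP => a; rewrite ord1; apply: ord2P; rewrite mxE.
Qed.

End SmoothPolynomials.

(** * Equations of the orbits in the affine charts *)

Section Charts.
Variable R : realType.
Local Notation C := (R[i]).
Local Notation Re := (@complex.Re R).
Local Notation Im := (@complex.Im R).
Local Notation V := 'rV[R]_4.
Implicit Types (x : V) (O : set (Psl2C R)).

Local Notation polyexp := (polyexp R).
Definition Xc (i : nat) : polyexp := Coord R (inord i).

Definition Opp (e : polyexp) : polyexp := Mul (Const (- 1)) e.
Definition Sqr (e : polyexp) : polyexp := Mul e e.

Definition chart_h (j : 'I_3) : polyexp :=
  Mul (Const 2) (if val j is 0%N
    then Add (Const 1) (Add (Mul (Xc 0) (Xc 2)) (Mul (Xc 1) (Xc 3)))
    else Add (Add (Sqr (Xc 0)) (Sqr (Xc 1))) (Xc 2)).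

Definition chart_qRe (j : 'I_3) : polyexp :=
  if val j is 0%N
  then Add (Const 1) (Add (Mul (Xc 0) (Xc 2)) (Opp (Mul (Xc 1) (Xc 3))))
  else Add (Add (Sqr (Xc 0)) (Opp (Sqr (Xc 1)))) (Xc 2).

Definition chart_qIm (j : 'I_3) : polyexp :=
  if val j is 0%N
  then Add (Mul (Xc 0) (Xc 3)) (Mul (Xc 1) (Xc 2))
  else Add (Mul (Const 2) (Mul (Xc 0) (Xc 1))) (Xc 3).

Definition chart_q2 j : polyexp := Add (Sqr (chart_qRe j)) (Sqr (chart_qIm j)).

Lemma affine_chartE (j : 'I_3) x :
  let u := Complex (x 0 (inord 0)) (x 0 (inord 1)) in
  let v := Complex (x 0 (inord 2)) (x 0 (inord 3)) in
  affine_chart j x = match val j with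
                     | 0%N => sl2mx 1 u v
                     | 1%N => sl2mx u 1 v
                     | _ => sl2mx u v 1
                     end.
Proof. by []. Qed.

Lemma hform_chart j x : hform (affine_chart j x) = peval (chart_h j) x.
Proof.
rewrite affine_chartE /hform; case: j => [[|[|[|//]]] ?] /=; rewrite !sl2mxE /=; ring.
Qed.

Lemma qform_chart j x : nrm2 (qform (affine_chart j x)) = peval (chart_q2 j) x.
Proof.
rewrite affine_chartE /nrm2 /qform; case: j => [[|[|[|//]]] ?] /=; rewrite !sl2mxE /=; ring.
Qed.

Lemma affine_chart_neq0 j x : affine_chart j x != 0.
Proof.
apply/eqP => /matrixP e; have h00 := e 0 0; have h01 := e 0 1; have h10 := e 1 0.
move: h00 h01 h10 {e}; rewrite affine_chartE; case: j => [[|[|[|//]]] ?] /=;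
  rewrite !sl2mxE !mxE => h1 h2 h3; move/eqP: (oner_neq0 C); exact.
Qed.

Lemma affine_chart_sl2C j x : affine_chart j x \in sl2C R.
Proof.
rewrite mem_sl2C affine_chartE; case: j => [[|[|[|//]]] ?] /=; rewrite !sl2mxE //.
Qed.

Lemma chart_point j x : exists p : Psl2C R, val p = <[affine_chart j x]>%VS.
Proof.
have H : (<[affine_chart j x]> <= sl2C R)%VS && (\dim <[affine_chart j x]> == 1%N).
  by rewrite -memvE affine_chart_sl2C dim_vline affine_chart_neq0.
pose P (l : {vspace 'M[C]_2}) := (l <= sl2C R)%VS && (\dim l == 1%N).
by exists (exist P _ H).
Qed.

Lemma orbit_pairs_forms (p : Psl2C R) (t : R) : 1 <= t \/ t < - 1 ->
  orbit_pairs t (root_pair p) <->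
  regular_mx (pt_rep p) /\ form_rel t (pt_rep p).
Proof.
move=> ht; have [t1 _] := param_range ht; rewrite -regular_ptsE.
have [z' [w' e]] := upair_exists (root_pair p).
have [k k0 ->] := root_pair_rep e.
rewrite form_relZ//; split=> [h|[r f]].
  have r := normal_pair_regular ht h; split=> //.
  have [z [w [ez ew z0 w0 zw]]] := (regular_pts_rep e).1 r.
  move: h; rewrite e ez ew => /orbit_pairsP -/(_ t1)[_ _ h].
  by apply/form_rel_pair.
have [z [w [ez ew z0 w0 zw]]] := (regular_pts_rep e).1 r.
rewrite e ez ew; apply/orbit_pairsP => //; split=> //.
by apply/form_rel_pair; rewrite -ez -ew.
Qed.

(** Orbits meet the charts in sets described by the two forms, which are
    polynomials in the chart coordinates. *)
Lemma chart_set O j (t : R) x : 1 <= t \/ t < - 1 ->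
  (@root_pair R) @` O = orbit_pairs t ->
  (exists2 p : Psl2C R, O p & val p = <[affine_chart j x]>%VS) <->
  regular_mx (affine_chart j x) /\ form_rel t (affine_chart j x).
Proof.
move=> ht eO.
have rep (p : Psl2C R) : val p = <[affine_chart j x]>%VS ->
    orbit_pairs t (root_pair p) <->
    regular_mx (affine_chart j x) /\ form_rel t (affine_chart j x).
  move=> e; rewrite orbit_pairs_forms//.
  have [vp _ p0] := pt_repP p; rewrite vp in e.
  have [k k0 ->] := vline_eq p0 e.
  by rewrite regular_mxZ// form_relZ.
split=> [[p Op e]|h].
  by apply/(rep _ e); rewrite -eO; exists p.
have [p e] := chart_point j x; exists p => //.
have : orbit_pairs t (root_pair p) by apply/(rep _ e).
by rewrite -eO => -[q Oq /(bij_inj (@root_pair_bij R)) <-].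
Qed.

Lemma form_rel1 (L : 'M[C]_2) : regular_mx L /\ form_rel 1 L <->
  nrm2 (qform L) = 0 /\ 0 < hform L ^+ 2.
Proof.
rewrite /regular_mx /form_rel subrr expr0n mul0r; split=> [[r e]|[-> h]].
  have q0 : nrm2 (qform L) = 0.
    have /eqP : Num.sqrt (nrm2 (qform L)) = 0 by lra.
    by rewrite sqrtr_eq0 => h; apply/eqP; rewrite eq_le h nrm2_ge0.
  by rewrite q0 mulr0 in r *; split=> //; rewrite lt_neqAle eq_sym r sqr_ge0.
by rewrite mulr0 sqrtr0 mulr0 lt0r_neq0.
Qed.

(** The numerator of h / (2 |q|); the denominator is (t - 1)^2. *)
Definition ratio_num (t : R) : R := t ^+ 2 + 6 * t + 1.

(** Squaring removes the modulus of q and gives a polynomial equation; the sign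
    of h recovers the relation. *)
Lemma form_rel_hyper (t : R) (L : 'M[C]_2) : 1 < t \/ t < - 1 -> ratio_num t != 0 ->
  regular_mx L /\ form_rel t L <->
  (t - 1) ^+ 4 * hform L ^+ 2 = 4 * ratio_num t ^+ 2 * nrm2 (qform L) /\
  0 < ratio_num t * hform L.
Proof.
move=> ht m0; rewrite /regular_mx /form_rel -/(ratio_num t).
set m := ratio_num t in m0 *; set h := hform L; set n := nrm2 (qform L).
have n0 : 0 <= n by exact: nrm2_ge0.
pose s := Num.sqrt n; have s0 : 0 <= s by exact: sqrtr_ge0.
have sn : n = s ^+ 2 by rewrite sqr_sqrtr.
pose T := (t - 1) ^+ 2.
have T0 : 0 < T by rewrite exprn_even_gt0 //= subr_eq0; case: ht => ht; apply/eqP; lra.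
(* Equality occurs at t = -1, the parameter of the conjugate pairs. *)
have mT : m ^+ 2 != T ^+ 2.
  rewrite -subr_eq0.
  have -> : m ^+ 2 - T ^+ 2 = (8 * t) * (2 * (t + 1) ^+ 2) by rewrite /m /T /ratio_num; ring.
  by rewrite !mulf_neq0 ?pnatr_eq0 ?expf_neq0//; case: ht => ht; apply/eqP; lra.
have -> : (t - 1) ^+ 4 = T ^+ 2 by rewrite /T -exprM.
rewrite -/s -/T sn; split=> [[r e]|[e mh]].
  have sp : 0 < s.
    rewrite lt_neqAle s0 andbT; apply: contra_neq r => se.
    have h0 : h = 0.
      by apply: (mulfI (lt0r_neq0 T0)); rewrite e -se !mulr0.
    by rewrite h0 -se expr0n mulr0.
  split; first by rewrite -exprMn e; ring.
  rewrite -(pmulr_rgt0 _ T0) mulrCA e.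
  have -> : m * (2 * m * s) = 2 * (m ^+ 2 * s) by ring.
  by apply: mulr_gt0 => //; apply: mulr_gt0 => //; rewrite exprn_even_gt0.
have mh0 : h != 0 by apply: contraTneq mh => ->; rewrite mulr0 ltxx.
split.
  apply: contra_neq mT => hh; apply: (mulIf (expf_neq0 2 mh0)).
  rewrite [RHS]e hh; ring.
have /eqP : (T * h) ^+ 2 = (2 * m * s) ^+ 2 by rewrite exprMn e; ring.
rewrite eqf_sqr => /orP[/eqP//|/eqP e'].
have : 0 < T * (m * h) by rewrite mulr_gt0.
rewrite mulrCA e'.
have -> : m * - (2 * m * s) = - (2 * (m ^+ 2 * s)) by ring.
rewrite oppr_gt0 ltNge; have -> // : 0 <= 2 * (m ^+ 2 * s).
by apply: mulr_ge0 => //; apply: mulr_ge0 => //; exact: sqr_ge0.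
Qed.

(** For t = - 3 - 2 sqrt 2 the squared equation would be the square of h = 0
    and have a vanishing differential. *)
Lemma form_rel_ratio0 (t : R) (L : 'M[C]_2) : 1 < t \/ t < - 1 -> ratio_num t = 0 ->
  regular_mx L /\ form_rel t L <-> hform L = 0 /\ 0 < nrm2 (qform L).
Proof.
move=> ht m0; rewrite /regular_mx /form_rel -/(ratio_num t) m0 mulr0 mul0r.
have T0 : (t - 1) ^+ 2 != 0.
  by rewrite expf_neq0// subr_eq0; case: ht => ht; apply/eqP; lra.
split=> [[r /eqP]|[-> n0]].
  rewrite mulf_eq0 (negbTE T0) => /eqP h0; split=> //.
  rewrite lt_neqAle nrm2_ge0 andbT eq_sym; apply: contra_neq r => ->.
  by rewrite h0 expr0n mulr0.
by rewrite expr0n mulr0 eq_sym mulf_neq0 ?pnatr_eq0 ?lt0r_neq0.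
Qed.
Lemma delta_coord a b : (a < 4)%N -> (b < 4)%N ->
  (delta_mx 0 (inord a) : V) 0 (inord b) = (b == a)%:R.
Proof.
move=> a4 b4; rewrite mxE eqxx /=; congr (_%:R); congr nat_of_bool.
by apply/eqP/eqP => [/(congr1 val)|->//]; rewrite /= !inordK.
Qed.

Definition hyper_eq (A B : R) j : polyexp :=
  Add (Mul (Const A) (Sqr (chart_h j))) (Opp (Mul (Const B) (chart_q2 j))).

Lemma hyper_eqE (A B : R) j x : peval (hyper_eq A B j) x =
  A * peval (chart_h j) x ^+ 2 - B * peval (chart_q2 j) x.
Proof. by rewrite /hyper_eq /= mulN1r expr2. Qed.

(** At a critical point the norm of the gradient equations and the equation
    itself combine to A h^2 (4 A - B) = 0.  In the first chart this needs the second
    complex coordinate to be nonzero; where it vanishes, h = 2 and q = 1, and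
    the equation itself gives 4 A = B. *)
Lemma hyper_eq_regular (A B : R) j x : A != 0 -> 4 * A != B ->
  peval (hyper_eq A B j) x = 0 -> peval (chart_h j) x != 0 ->
  exists i, pder (hyper_eq A B j) x (delta_mx 0 i) != 0.
Proof.
move=> A0 AB F0 h0; apply: contrapT => noi.
have D i : pder (hyper_eq A B j) x (delta_mx 0 i) = 0.
  by apply/eqP; apply: contrapT => /negP hi; apply: noi; exists i.
have D0 := D (inord 0); have D1 := D (inord 1).
have D2 := D (inord 2); have D3 := D (inord 3).
move: F0 h0 D0 D1 D2 D3 {D noi}.
rewrite /hyper_eq /chart_q2 /chart_h /chart_qRe /chart_qIm.
case: j => [[|j] jlt] /=; rewrite !delta_coord //=;
  move: (x 0 (inord 0) : R) (x 0 (inord 1) : R) (x 0 (inord 2) : R)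
    (x 0 (inord 3) : R) => x0 x1 x2 x3.
  set h := (2 * _); set P := (1 + (_ + -1 * _)); set S := (x0 * x3 + _).
  move=> F0 h0 D0 D1 _ _.
  have e1 : 2 * A * h * x2 = B * (P * x2 + S * x3) by lra.
  have e2 : 2 * A * h * x3 = B * (S * x2 - P * x3) by lra.
  have : A * h ^+ 2 * (4 * A - B) * (x2 ^+ 2 + x3 ^+ 2) = 0.
    transitivity ((2 * A * h * x2) ^+ 2 + (2 * A * h * x3) ^+ 2 -
      B * (x2 ^+ 2 + x3 ^+ 2) * (A * (h * h) + -1 * (B * (P * P + S * S))
        + B * (P * P + S * S))); first by ring.
    by rewrite F0 e1 e2; ring.
  have nz : A * h ^+ 2 * (4 * A - B) != 0.
    by apply: mulf_neq0; [apply: mulf_neq0 => //; exact: expf_neq0|rewrite subr_eq0].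
  move/eqP; rewrite mulf_eq0 (negbTE nz) /=.
  rewrite paddr_eq0 ?sqr_ge0// !sqrf_eq0 => /andP[/eqP x20 /eqP x30].
  move/eqP: AB; apply; move: F0; rewrite /h /P /S x20 x30.
  lra.
set h := (2 * _); set P := (_ + x2); set S := (_ + x3).
move=> F0 h0 _ _ D2 D3.
have e1 : 2 * A * h = B * P by lra.
have e2 : B * S = 0 by lra.
have : A * h ^+ 2 * (4 * A - B) = 0.
  transitivity ((2 * A * h) ^+ 2 - B * (A * (h * h) + -1 * (B * (P * P + S * S))
      + B * (P * P + S * S))); first by ring.
  by rewrite F0 e1; transitivity (- (B * S) ^+ 2); [ring|rewrite e2; ring].
apply/eqP; apply: mulf_neq0; last by rewrite subr_eq0.
by apply: mulf_neq0 => //; exact: expf_neq0.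
Qed.

Lemma chart_h_regular j x : peval (chart_h j) x = 0 ->
  exists i, pder (chart_h j) x (delta_mx 0 i) != 0.
Proof.
move=> h0; apply: contrapT => noi.
have D i : pder (chart_h j) x (delta_mx 0 i) = 0.
  by apply/eqP; apply: contrapT => /negP hi; apply: noi; exists i.
have D0 := D (inord 0); have D1 := D (inord 1); have D2 := D (inord 2).
move: h0 D0 D1 D2 {D noi}; rewrite /chart_h.
case: j => [[|j] jlt] /=; rewrite !delta_coord //=;
  move: (x 0 (inord 0) : R) (x 0 (inord 1) : R) (x 0 (inord 2) : R)
    (x 0 (inord 3) : R) => x0 x1 x2 x3.
  move=> h0 D0 D1 _.
  have x20 : x2 = 0 by lra.
  have x30 : x3 = 0 by lra.
  by rewrite x20 x30 in h0; lra.
by move=> _ _ _; lra.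
Qed.

(** The partial derivatives of q form a Cauchy-Riemann matrix, which is
    invertible where the holomorphic derivative of q does not vanish. *)
Lemma chart_q_regular j x (a b : R) : peval (chart_qRe j) x = 0 ->
  (forall i, a * pder (chart_qRe j) x (delta_mx 0 i) +
             b * pder (chart_qIm j) x (delta_mx 0 i) = 0) -> a = 0 /\ b = 0.
Proof.
move=> P0 D; have D0 := D (inord 0); have D1 := D (inord 1).
have D2 := D (inord 2); have D3 := D (inord 3).
move: P0 D0 D1 D2 D3 {D}; rewrite /chart_qRe /chart_qIm.
case: j => [[|j] jlt] /=; rewrite !delta_coord //=;
  move: (x 0 (inord 0) : R) (x 0 (inord 1) : R) (x 0 (inord 2) : R)
    (x 0 (inord 3) : R) => x0 x1 x2 x3.
  move=> P0 D0 D1 _ _.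
  have e1 : a * x2 + b * x3 = 0 by lra.
  have e2 : b * x2 - a * x3 = 0 by lra.
  have n0 : x2 ^+ 2 + x3 ^+ 2 != 0.
    rewrite paddr_eq0 ?sqr_ge0// !sqrf_eq0; apply/negP => /andP[/eqP x20 /eqP x30].
    by rewrite x20 x30 in P0; lra.
  split; apply: (mulIf n0); rewrite mul0r.
    by transitivity (x2 * (a * x2 + b * x3) - x3 * (b * x2 - a * x3)); [ring|rewrite e1 e2; ring].
  by transitivity (x3 * (a * x2 + b * x3) + x2 * (b * x2 - a * x3)); [ring|rewrite e1 e2; ring].
by move=> _ _ _ D2 D3; split; lra.
Qed.

Lemma has_dim_hypersurface O (t : R) : 1 < t \/ t < - 1 ->
  (@root_pair R) @` O = orbit_pairs t -> has_dim O 3.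
Proof.
move=> ht eO; have ht' : 1 <= t \/ t < - 1 by case: ht => [/ltW|]; [left|right].
split=> // j; have [m0|m0] := eqVneq (ratio_num t) 0.
  apply: (@hypersurface _ _ (chart_h j) (chart_q2 j)) => [x|x]; rewrite /mkset.
    rewrite (chart_set _ _ ht' eO) (form_rel_ratio0 _ ht m0).
    by rewrite hform_chart qform_chart.
  rewrite (chart_set _ _ ht' eO) (form_rel_ratio0 _ ht m0).
  by rewrite hform_chart => -[h0 _]; exact: chart_h_regular.
pose A := (t - 1) ^+ 4; pose B := 4 * ratio_num t ^+ 2.
have A0 : A != 0.
  by rewrite expf_neq0// subr_eq0; case: ht => ht; apply/eqP; lra.
have AB : 4 * A != B.
  rewrite -subr_eq0.
  have -> : 4 * A - B = - (4 * (8 * t) * (2 * (t + 1) ^+ 2)) by rewrite /A /B /ratio_num; ring.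
  by rewrite oppr_eq0 !mulf_neq0 ?pnatr_eq0 ?expf_neq0//; case: ht => ht; apply/eqP; lra.
have SE x : (exists2 p : Psl2C R, O p & val p = <[affine_chart j x]>%VS) <->
    peval (hyper_eq A B j) x = 0 /\ 0 < peval (Mul (Const (ratio_num t)) (chart_h j)) x.
  rewrite (chart_set _ _ ht' eO) (form_rel_hyper _ ht m0).
  rewrite hform_chart qform_chart hyper_eqE -/A -/B.
  split=> -[e h0]; split=> //; first by rewrite e subrr.
  by apply/eqP; rewrite -subr_eq0 e.
apply: (hypersurface SE) => x /SE[F0 G0]; apply: hyper_eq_regular => //.
by apply: contraTneq G0 => /= ->; rewrite mulr0 ltxx.
Qed.

Lemma has_dim_double O : (@root_pair R) @` O = orbit_pairs 1 -> has_dim O 2.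
Proof.
move=> eO; have ht : 1 <= (1 : R) \/ (1 : R) < - 1 by left.
split=> // j.
have SE x : (exists2 p : Psl2C R, O p & val p = <[affine_chart j x]>%VS) <->
    [/\ peval (chart_qRe j) x = 0, peval (chart_qIm j) x = 0 &
        0 < peval (Sqr (chart_h j)) x].
  rewrite (chart_set _ _ ht eO) form_rel1 hform_chart qform_chart /= expr2.
  split=> [[/eqP + ->]|[-> -> ->]]; last by rewrite mulr0 addr0.
  by rewrite -!expr2 paddr_eq0 ?sqr_ge0// !sqrf_eq0 => /andP[/eqP-> /eqP->].
apply: (codim2_zero_set SE) => x /SE[P0 _ _] a b; exact: chart_q_regular.
Qed.

End Charts.

(** * The orbits and the two families *)

Section Assembly.
Variable R : realType.
Implicit Types (d t : R) (p q : Psl2C R) (O : set (Psl2C R)).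

Lemma normal_pair_orbit_exists t : 1 <= t \/ t < - 1 -> exists2 p,
  Defs.orbit p `<=` @regular_pts R &
  (@root_pair R) @` Defs.orbit p = orbit_pairs t.
Proof.
move=> ht; have [t1 _] := param_range ht.
have [f _ fK] := @root_pair_bij R.
pose p := f (upair (Some (Complex 0 1)) (Some (Complex 0 t))).
have hp : orbit_pairs t (root_pair p).
  by rewrite fK; exists (Complex 0 1), (Complex 0 t); split=> //; exact: normal_pair_base.
have rp := normal_pair_regular ht hp.
exists p; last exact: root_pair_orbit.
by move=> q /orbit_regular[+ _]; apply.
Qed.

Lemma expR_range d : 0 <= d -> 1 <= expR d \/ expR d < - 1.
Proof. by move=> d0; left; rewrite -expR0 ler_expR. Qed.

Lemma expRN_range d : 0 < d -> 1 <= - expR d \/ - expR d < - 1.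
Proof. by move=> d0; right; rewrite ltrN2 -expR0 ltr_expR. Qed.

Lemma regular_orbit_family p : Defs.orbit p `<=` @regular_pts R ->
  (exists2 d, 0 <= d & (@root_pair R) @` Defs.orbit p = familyI d) \/
  (exists2 d, 0 < d & (@root_pair R) @` Defs.orbit p = familyII d).
Proof.
move=> sub; have rp := sub _ (orbit_refl p).
have [t ht hp] := regular_normal_pair rp; have [t1 _] := param_range ht.
have e := root_pair_orbit t1 rp hp.
case: ht => ht; [left|right].
  exists (ln t); first exact: ln_ge0.
  by rewrite familyIE ?ln_ge0// lnK// posrE (lt_le_trans ltr01).
have Nt : 1 < - t by rewrite ltrNr.
exists (ln (- t)); first exact: ln_gt0.
by rewrite familyIIE ?ln_gt0// lnK ?opprK// posrE (lt_trans ltr01).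
Qed.

Lemma familyI_inj : {in [set d : R | 0 <= d] &, injective (@familyI R)}.
Proof.
move=> d d'; rewrite !inE /= => d0 d0'; rewrite !familyIE//.
have [t1 _] := param_range (expR_range d0).
have [t1' _] := param_range (expR_range d0').
by move=> /(orbit_pairs_inj t1 t1')/expR_inj.
Qed.

Lemma familyII_inj : {in [set d : R | 0 < d] &, injective (@familyII R)}.
Proof.
move=> d d'; rewrite !inE /= => d0 d0'; rewrite !familyIIE//.
have [t1 _] := param_range (expRN_range d0).
have [t1' _] := param_range (expRN_range d0').
by move=> /(orbit_pairs_inj t1 t1')/oppr_inj/expR_inj.
Qed.

Lemma nonregular_orbit p : ~ (Defs.orbit p `<=` @regular_pts R) ->
  Defs.orbit p `<=` @real_pts R \/
  Defs.orbit p `<=` @degenerate_pts R `\` @real_pts R.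
Proof.
move=> nsub; have [rp|nrp] := pselect (real_pts p).
  by left=> q /orbit_real[+ _]; apply.
right=> q oq; have nrq : ~ real_pts q by move/(orbit_real oq).
split=> //; apply: contrapT => ndq; apply: nsub => q' oq'.
have : regular_pts q by move=> [].
by move/(orbit_regular oq)/(orbit_regular oq').
Qed.

Lemma real_pts_pairs : @real_pts R = (@root_pair R) @^-1` (@real_pairs R).
Proof.
apply/funext => p; apply/propext.
have [z [w e]] := upair_exists (root_pair p).
by rewrite /preimage /= e; exact: real_pts_rep.
Qed.

Lemma degenerate_pts_pairs : @degenerate_pts R `\` @real_pts R =
  (@root_pair R) @^-1` (@one_real_pairs R).
Proof.
apply/funext => p; apply/propext.
have [z [w e]] := upair_exists (root_pair p).
rewrite /preimage /= e; split=> [[dp nrp]|h].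
  exact/(degenerate_not_real e nrp).
have nrp : ~ real_pts p.
  rewrite (real_pts_rep e) real_pairsP.
  move/one_real_pairsP: h => h [[hz hw]|zw]; first by case: h => -[].
  have zwR : RP1 z <-> RP1 w by rewrite zw -!CP1_conj_fix CP1_conjK; split=> /esym.
  by case: h => -[h1 h2]; [apply: h2; apply/zwR|apply: h1; apply/zwR].
by split=> //; apply/(degenerate_not_real e nrp).
Qed.

End Assembly.

Theorem proposition4p1 (R : realType) :
  [/\ (* the orbits in the regular set are the members of the two families *)
      [set (@root_pair R) @` O | O in [set O | orbits O /\ O `<=` @regular_pts R]]
        = (@familyI R) @` [set d | 0 <= d] `|` (@familyII R) @` [set d | 0 < d],
      (* family I, parametrized by [0, oo) *)
      [/\ {in [set d | 0 <= d] &, injective (@familyI R)},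
          familyI 0 = @double_nonreal R,
          forall O : set (Psl2C R), orbits O ->
            (@root_pair R) @` O = familyI 0 -> has_dim O 2
        & forall (O : set (Psl2C R)) (d : R), orbits O -> 0 < d ->
            (@root_pair R) @` O = familyI d -> has_dim O 3],
      (* family II, parametrized by (0, oo) *)
      {in [set d | 0 < d] &, injective (@familyII R)} /\
      (forall (O : set (Psl2C R)) (d : R), orbits O -> 0 < d ->
         (@root_pair R) @` O = familyII d -> has_dim O 3)
    & (* the other orbits *)
      [/\ forall O : set (Psl2C R), orbits O -> ~ (O `<=` @regular_pts R) ->
            O `<=` @real_pts R \/ O `<=` @degenerate_pts R `\` @real_pts R,
          @real_pts R = (@root_pair R) @^-1` (@real_pairs R)
        & @degenerate_pts R `\` @real_pts R =
            (@root_pair R) @^-1` (@one_real_pairs R)]].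
Proof.
split.
- apply/seteqP; split=> F.
    move=> [S [[p _ <-] sub] <-].
    by case: (regular_orbit_family sub) => -[d d0 ->]; [left|right]; exists d.
  move=> [|] [d d0 <-].
    have [p sub e] := normal_pair_orbit_exists (expR_range d0).
    by exists (Defs.orbit p); [split=> //; exists p|rewrite e familyIE].
  have [p sub e] := normal_pair_orbit_exists (expRN_range d0).
  by exists (Defs.orbit p); [split=> //; exists p|rewrite e familyIIE].
- split.
  + exact: familyI_inj.
  + exact: familyI0.
  + move=> O _; rewrite familyIE// expR0; exact: has_dim_double.
  + move=> O d _ d0; rewrite familyIE ?(ltW d0)//; apply: has_dim_hypersurface.
    by left; rewrite -expR0 ltr_expR.
- split; first exact: familyII_inj.
  move=> O d _ d0; rewrite familyIIE//; apply: has_dim_hypersurface.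
  by right; rewrite ltrN2 -expR0 ltr_expR.
- split.
  + by move=> O [p _ <-]; exact: nonregular_orbit.
  + exact: real_pts_pairs.
  + exact: degenerate_pts_pairs.
Qed.
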